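(* The competitive ratio of the MLE satisfies $$\lim_{d\to\infty}\mathfrak C^{\mathsf{MLE}}(r\mathsf B^d_p,\sigma)=\infty$$ in each of the following situations: (i) $p\in(1,2)$ is fixed, independent of $d$, and $\sigma=\sigma(d)>0$, $r=r(d)>0$ are any sequences of noise levels and radii with $\sigma d^{1/p}\gg r$ and $\sigma\sqrt{\log d}\ll r$; (ii) $p=p(d)$ is a sequence of norm indices with $p(d)-1\gg\tfrac{1}{1+\log d}$ and $\limsup_{d\to\infty}p(d)<2$, and $\sigma=\sigma(d)>0$, $r=r(d)>0$ are any sequences with $\sigma d^{1/p}\gg r\,d^{2/p-1}\big(1-\tfrac1p\big)^{1/2}$ and $\sigma\sqrt{\log d}\ll r$ (with $p=p(d)$).
   Context: For nonnegative sequences, $f(d)\gg g(d)$ means $f(d)/g(d)\to\infty$ as $d\to\infty$, and $f\ll g$ means $g\gg f$. For $p\ge1$, $r\mathsf{B}^d_p=\{x\in\mathbf{R}^d:\|x\|_p\le r\}$ where $\|x\|_p=(\sum_i|x_i|^p)^{1/p}$. For a closed convex set $\Theta\subset\mathbf{R}^d$, $\Pi_\Theta(y)=\arg\min_{\vartheta\in\Theta}\|\vartheta-y\|_2^2$ is the Euclidean projection (the maximum likelihood estimator, MLE, in the model $Y\sim\mathsf N(\theta^\star,\sigma^2I_d)$, $\theta^\star\in\Theta$). Define $$\mathcal R^{\mathsf{MLE}}(\Theta,\sigma)=\sup_{\theta^\star\in\Theta}\mathbf E_{Y\sim\mathsf N(\theta^\star,\sigma^2I_d)}\|\Pi_\Theta(Y)-\theta^\star\|_2^2,\qquad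 \mathcal M(\Theta,\sigma)=\inf_{\hat\theta}\sup_{\theta^\star\in\Theta}\mathbf E_{Y\sim\mathsf N(\theta^\star,\sigma^2I_d)}\|\hat\theta(Y)-\theta^\star\|_2^2,$$ the infimum being over all measurable $\hat\theta:\mathbf R^d\to\mathbf R^d$, and $\mathfrak C^{\mathsf{MLE}}(\Theta,\sigma)=\mathcal R^{\mathsf{MLE}}(\Theta,\sigma)/\mathcal M(\Theta,\sigma)$. *)

(* Defs.v *)
From HB Require Import structures.
From mathcomp Require Import all_boot all_order all_algebra.
From mathcomp Require Import all_classical all_reals all_analysis.

Set Implicit Arguments.
Unset Strict Implicit.
Unset Printing Implicit Defensive.

Import Order.TTheory GRing.Theory Num.Theory.
Import numFieldNormedType.Exports.

Local Open Scope classical_set_scope.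
Local Open Scope ring_scope.

(* R^d is [d.-tuple R]; as a measurable space it is
   [d.-tuple (measurableTypeR R)], with the product of the Borel sigma-algebras,
   since [measurableTypeR R] is the space on which [normal_prob] lives. *)

Section tuple_product.
Context {dT : measure_display} {T : measurableType dT} {R : realType}.

Definition tuple_cons n (z : T * n.-tuple T) : n.+1.-tuple T :=
  [tuple of z.1 :: z.2].

Lemma measurable_tuple_cons n : measurable_fun [set: _] (@tuple_cons n).
Proof. exact: measurable_cons. Qed.

HB.instance Definition _ n :=
  isMeasurableFun.Build _ _ _ _ (@tuple_cons n) (@measurable_tuple_cons n).

Fixpoint tuple_prob n : ('I_n -> probability T R) -> probability (n.-tuple T) R :=
  if n is m.+1 return ('I_n -> probability T R) -> probability (n.-tuple T) R
  then fun P =>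
    distribution (P ord0 \x tuple_prob (fun i => P (lift ord0 i)))%E
                 (@tuple_cons m)
  else fun=> dirac [tuple].

Lemma tuple_probE n (P : 'I_n -> probability T R) (A : 'I_n -> set T) :
  (forall i, measurable (A i)) ->
  tuple_prob P [set x | forall i, A i (tnth x i)] = (\prod_i P i (A i))%E.
Proof.
elim: n P A => [|n IH] P A mA.
  rewrite big_ord0 /= diracE mem_set //; by case.
rewrite big_ord_recl /= /distribution /pushforward /=.
have -> : @tuple_cons n @^-1` [set x | forall i, A i (tnth x i)] =
    A ord0 `*` [set x | forall i, A (lift ord0 i) (tnth x i)].
  apply/seteqP; split => -[x y] /=.
    by move=> H; split=> [|i]; [have := H ord0|have := H (lift ord0 i)];
       rewrite /tuple_cons ?tnth0 ?tnthS.
  by move=> [Hx Hy] i; case: (unliftP ord0 i) => [j|] ->;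
     rewrite /tuple_cons ?tnth0 ?tnthS.
have IHA := IH (fun i => P (lift ord0 i)) (fun i => A (lift ord0 i)) (fun i => mA _).
rewrite product_measure1E //; first by rewrite -IHA.
have -> : [set x : n.-tuple T | forall i, A (lift ord0 i) (tnth x i)] =
    \bigcap_(i in [set: 'I_n]) ((fun x => tnth x i) @^-1` A (lift ord0 i)).
  by apply/seteqP; split => x H i => [_|]; exact: H.
apply: fin_bigcap_measurable; first exact: finite_finset.
by move=> i _; rewrite -[X in measurable X]setTI; exact: measurable_tnth.
Qed.

End tuple_product.

Section competitive_ratio.
Context {R : realType}.

Definition sqdist d (x y : d.-tuple R) : R :=
  \sum_(i < d) (tnth x i - tnth y i) ^+ 2.

Definition lp_norm d (p : R) (x : d.-tuple R) : R :=
  (\sum_(i < d) `|tnth x i| `^ p) `^ p^-1.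

Definition lp_ball d (p r : R) : set (d.-tuple R) :=
  [set x | lp_norm p x <= r].

(* [normal_prob m s] is parametrised by the standard deviation [s]. *)
Definition gauss d (theta : d.-tuple R) (sigma : R) :
    probability (d.-tuple (measurableTypeR R)) R :=
  tuple_prob (fun i => normal_prob (tnth theta i) sigma).

(* The set over which [xget] chooses is a singleton when [Theta] is nonempty,
   closed and convex; otherwise the value may be junk. *)
Definition euclid_proj d (Theta : set (d.-tuple R)) (y : d.-tuple R) : d.-tuple R :=
  xget y [set t | Theta t /\ forall u, Theta u -> sqdist t y <= sqdist u y].

Definition max_risk d (Theta : set (d.-tuple R)) (sigma : R)
    (est : d.-tuple R -> d.-tuple R) : \bar R :=
  ereal_sup [set 'E_(gauss theta sigma)[fun y => sqdist (est y) theta]%E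
            | theta in Theta].

Definition mle_risk d (Theta : set (d.-tuple R)) (sigma : R) : \bar R :=
  max_risk Theta sigma (euclid_proj Theta).

Definition minimax_risk d (Theta : set (d.-tuple R)) (sigma : R) : \bar R :=
  ereal_inf [set max_risk Theta sigma est
            | est in [set est : d.-tuple (measurableTypeR R) ->
                                d.-tuple (measurableTypeR R)
                     | measurable_fun [set: _] est]].

Definition competitive_ratio d (Theta : set (d.-tuple R)) (sigma : R) : \bar R :=
  (mle_risk Theta sigma / minimax_risk Theta sigma)%E.

(* [much_greater f g] is f(d) >> g(d) as d tends to infinity. *)
Definition much_greater (f g : nat -> R) : Prop :=
  (fun d => f d / g d) @ \oo --> +oo.

End competitive_ratio.

Arguments lp_ball {R} d p r.

(* Main.v *)
(** Write q = p / (p - 1).  Upper bound on the minimax risk: coordinatewise hard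
    thresholding at level 6 m has risk at most
    46 r^p m^(2-p) on the l_p ball as soon as d s^2 exp(- m^2 / s^2) is at most
    r^p m^(2-p); take m = s sqrt(ln d) or, when r is close to s d^(1/p),
    m = s sqrt(ln (d s^p / r^p)).

    Lower bound on the risk of the MLE: let theta have k entries equal to
    a = r k^(-1/p), so that it lies on the boundary of the ball.  If the projection
    of theta + s g were close to theta, almost all of its l_p budget would be spent
    on the support of theta, and by Hoelder it could collect from the noise outside
    of the support only a small fraction of r sqrt(q) d^(1/q).  But the vector of
    the ball that is constant on the coordinates with g_i >= sqrt q does collect an
    amount of this order, which beats the squared lengths of both vectors when
    r k^(1-2/p) <= e^(-9) s sqrt(q) d^(1/q).  Hence the risk is at least a constant
    times |theta|^2 = r^2 k^(1-2/p).  In case (ii), k = 1 is allowed; in case (i)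
    the smallest admissible k is used. *)

Require Import Defs.
From mathcomp Require Import all_boot all_order all_algebra.
From mathcomp Require Import all_classical all_reals all_analysis.
From mathcomp Require Import measurable_realfun.
From mathcomp Require Import ring lra.
Set Implicit Arguments.
Unset Strict Implicit.
Unset Printing Implicit Defensive.
Import Order.TTheory GRing.Theory Num.Theory.
Import numFieldNormedType.Exports.
Local Open Scope classical_set_scope.
Local Open Scope ring_scope.

(** * Product measures and Gaussian moments *)

Lemma measurable_prode_tnth (dT : measure_display) (T : measurableType dT)
    (R : realType) (n : nat) (f : 'I_n -> T -> \bar R) :
  (forall i, measurable_fun [set: T] (f i)) ->
  measurable_fun [set: n.-tuple T] (fun x => \prod_(i < n) f i (tnth x i))%E.
Proof.
move=> mf; have : forall i, measurable_fun [set: n.-tuple T]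
    (fun x => f i (tnth x i)).
  by move=> i; apply: measurableT_comp => //; exact: measurable_tnth.
elim: index_enum => [|i s IH] mg.
  by under eq_fun do rewrite big_nil; exact: measurable_cst.
by under eq_fun do rewrite big_cons; apply: emeasurable_funM => //; exact: IH.
Qed.

(** Independence of the coordinates. By induction on [n], Tonelli splits off the head of the tuple,
    and the integral over the tail is a constant factor of the integral over the head. *)
Lemma integral_tuple_prob_prod (dT : measure_display) (T : measurableType dT)
    (R : realType) (n : nat) (P : 'I_n -> probability T R)
    (f : 'I_n -> T -> \bar R) :
  (forall i, measurable_fun [set: T] (f i)) -> (forall i t, 0 <= f i t)%E ->
  (\int[tuple_prob P]_x \prod_(i < n) f i (tnth x i) =
   \prod_(i < n) \int[P i]_t f i t)%E.
Proof.
elim: n P f => [|n IH] P f mf f0.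
  rewrite big_ord0; under eq_integral do rewrite big_ord0.
  rewrite integral_cst// mul1e. exact: probability_setT.
rewrite /= ge0_integral_distribution; last 2 first.
- exact: measurable_prode_tnth.
- by move=> y; apply: prode_ge0.
rewrite fubini_tonelli1/=; last 2 first.
- apply: measurableT_comp; first exact: measurable_prode_tnth.
  exact: measurable_tuple_cons.
- by move=> y; apply: prode_ge0.
rewrite /fubini_F/= big_ord_recl -IH//.
have int0 : (0 <= \int[tuple_prob (fun i : 'I_n => P (lift ord0 i))]_x
    \prod_(i < n) f (lift ord0 i) (tnth x i))%E.
  by apply: integral_ge0 => x _; apply: prode_ge0.
rewrite muleC -ge0_integralZl//.
apply: eq_integral => x _; rewrite muleC -ge0_integralZl//.
- congr (integral _ _ _); apply/funext => y; rewrite big_ord_recl tnth0.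
  by congr (_ * _)%E; apply: eq_bigr => i _; rewrite tnthS.
- exact: (@measurable_prode_tnth _ _ _ _ (fun i => f (lift ord0 i))).
- by move=> y _; apply: prode_ge0.
Qed.

Lemma integral_tuple_prob_tnth (dT : measure_display) (T : measurableType dT)
    (R : realType) (n : nat) (P : 'I_n -> probability T R)
    (f : T -> \bar R) (j : 'I_n) :
  measurable_fun [set: T] f -> (forall t, 0 <= f t)%E ->
  (\int[tuple_prob P]_x f (tnth x j) = \int[P j]_t f t)%E.
Proof.
move=> mf f0; pose g (i : 'I_n) t := if i == j then f t else 1%E.
have gP (h : 'I_n -> \bar R) : (forall i, i != j -> h i = 1%E) ->
    (\prod_(i < n) h i = h j)%E.
  by move=> h1; rewrite (bigD1 j)//= big1 ?mule1// => i; apply: h1.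
transitivity (\int[tuple_prob P]_x \prod_(i < n) g i (tnth x i))%E.
  by apply: eq_integral => x _; rewrite gP /g ?eqxx// => i /negbTE ->.
rewrite integral_tuple_prob_prod; last 2 first.
- by move=> i; rewrite /g; case: eqP => // _; exact: measurable_cst.
- by move=> i t; rewrite /g; case: eqP.
rewrite gP /g ?eqxx// => i /negbTE ->.
by rewrite integral_cst// mul1e; exact: probability_setT.
Qed.

(** The Radon-Nikodym derivative of [normal_prob m s] and [normal_pdf m s] have the same integral
    over every measurable set, so they agree almost everywhere. *)
Lemma ge0_integral_normal_prob (R : realType) (m s : R)
    (f : measurableTypeR R -> \bar R) :
  measurable_fun [set: _] f -> (forall x, 0 <= f x)%E ->
  (\int[normal_prob m s]_x f x =
   \int[lebesgue_measure]_x (f x * (normal_pdf m s x)%:E))%E.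
Proof.
move=> mf f0.
rewrite -(Radon_Nikodym_SigmaFinite.change_of_variables (normal_prob_dominates m s))//=.
have mpdf : measurable_fun [set: measurableTypeR R]
    (fun x => (normal_pdf m s x)%:E).
  by apply/measurableT_comp => //; exact: measurable_normal_pdf.
have RNi := Radon_Nikodym_SigmaFinite.f_integrable (normal_prob_dominates m s).
apply: ae_eq_integral => //.
- by apply: emeasurable_funM => //; exact: measurable_int RNi.
- exact: emeasurable_funM.
- apply: ae_eqe_mul2l; apply: integral_ae_eq => //.
  move=> E _ mE.
  by rewrite -(Radon_Nikodym_SigmaFinite.f_integral (normal_prob_dominates m s)).
Qed.

(* The exponential moment is that of a Gaussian whose variance is doubled. *)
Lemma normal_prob_expR_sqr (R : realType) (m s : R) : 0 < s ->
  (\int[normal_prob m s]_x (expR (((x - m) / s) ^+ 2 / 4))%:E =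
   (Num.sqrt 2)%:E)%E.
Proof.
move=> s0; have s2 : 0 < s * Num.sqrt 2 by rewrite mulr_gt0// sqrtr_gt0.
rewrite ge0_integral_normal_prob; last 2 first.
- apply/measurable_EFinP; apply: measurableT_comp => //.
  apply: measurable_funM => //; apply: measurable_funX.
  by apply: measurable_funM => //; exact: measurable_funB.
- by move=> x; rewrite lee_fin expR_ge0.
rewrite -[RHS]mule1 -(integral_normal_pdf m (s * Num.sqrt 2)) -ge0_integralZl//.
- apply: eq_integral => x _; rewrite -!EFinM; congr (_%:E).
  rewrite !normal_pdfE ?gt_eqF// /normal_peak /normal_fun.
  rewrite (exprMn _ s) sqr_sqrtr//.
  have -> : Num.sqrt (s ^+ 2 * 2 * pi *+ 2) = Num.sqrt 2 * Num.sqrt (s ^+ 2 * pi *+ 2).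
    by rewrite -sqrtrM//; congr (Num.sqrt _); ring.
  rewrite invfM !mulrA divff ?mul1r; last by rewrite gt_eqF// sqrtr_gt0.
  rewrite mulrAC -expRD mulrC; congr (_ * expR _).
  by field; rewrite gt_eqF.
- by apply/measurable_EFinP; exact: measurable_normal_pdf.
- by move=> x _; rewrite lee_fin normal_pdf_ge0.
Qed.

(** The integral of a nonnegative function is a supremum over the simple functions below it, hence
    monotone whether or not [f] is measurable. In this form the bound applies directly to the loss
    of the projection. *)
Lemma ge0_integral_lower (d : measure_display) (T : measurableType d)
    (R : realType) (P : {measure set T -> \bar R}) (A : set T) (f : T -> R)
    (c : R) :
  measurable A -> 0 <= c -> (forall x, 0 <= f x) -> (forall x, A x -> c <= f x) ->
  (c%:E * P A <= \int[P]_x (f x)%:E)%E.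
Proof.
move=> mA c0 f0 cf.
have -> : (c%:E * P A = \int[P]_x (c * \1_A x)%:E)%E.
  under eq_integral do rewrite EFinM.
  rewrite ge0_integralZl//; first by rewrite integral_indic// setIT.
  - by apply/measurable_EFinP; exact: measurable_indic.
rewrite !ge0_integralTE//; last by move=> x; rewrite lee_fin mulr_ge0.
apply: le_ereal_sup => _ [h /= hc <-]; exists h => //= x.
apply: (le_trans (hc x)); rewrite lee_fin indicE.
by case: (boolP (x \in A)) => [/set_mem/cf|]; rewrite ?mulr1 ?mulr0.
Qed.

Lemma measurable_sum_tnth (dT : measure_display) (T : measurableType dT)
    (R : realType) (n : nat) (S : pred 'I_n) (f : 'I_n -> T -> R) :
  (forall i, measurable_fun [set: T] (f i)) ->
  measurable_fun [set: n.-tuple T] (fun x => \sum_(i < n | S i) f i (tnth x i)).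
Proof.
move=> mf; under eq_fun do rewrite big_mkcond.
apply: measurable_sum => i; case: (S i); last exact: measurable_cst.
by apply: measurableT_comp => //; exact: measurable_tnth.
Qed.

Lemma integral_sum_tnth_le (dT : measure_display) (T : measurableType dT)
    (R : realType) (n : nat) (P : 'I_n -> probability T R) (S : pred 'I_n)
    (f : 'I_n -> T -> R) (K : R) :
  (forall i, measurable_fun [set: T] (f i)) -> (forall i t, 0 <= f i t) ->
  (forall i, S i -> (\int[P i]_t (f i t)%:E <= K%:E)%E) ->
  (\int[tuple_prob P]_x (\sum_(i < n | S i) f i (tnth x i))%:E <=
   (#|S|%:R * K)%:E)%E.
Proof.
move=> mf f0 fK.
have mfE i : measurable_fun [set: T] (fun t => (f i t)%:E).
  exact/measurable_EFinP.
under eq_integral do rewrite -sumEFin -big_filter.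
rewrite ge0_integral_sum//; last 2 first.
- move=> i; apply: (measurableT_comp (mfE i)); exact: measurable_tnth.
- by move=> i x _; rewrite lee_fin.
rewrite big_filter; apply: (@le_trans _ _ (\sum_(i < n | S i) K%:E)%E).
  apply: lee_sum.
  move=> i Si; rewrite (integral_tuple_prob_tnth P (f := fun t => (f i t)%:E))//.
    exact: fK.
  by move=> t; rewrite lee_fin.
by rewrite sumEFin sumr_const mulr_natl.
Qed.

(* Chernoff's bound, with the exponential moment of minus the count. *)
Lemma tuple_prob_count_tail (dT : measure_display) (T : measurableType dT)
    (R : realType) (n : nat) (P : 'I_n -> probability T R) (S : pred 'I_n)
    (B : 'I_n -> set T) (w : R) :
  (forall i, measurable (B i)) -> 0 <= w ->
  (forall i, S i -> (w%:E <= P i (B i))%E) ->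
  (tuple_prob P [set x | (\sum_(i < n | S i) \1_(B i) (tnth x i) <=
                         #|S|%:R * w / 4)%R] <= (expR (- (#|S|%:R * w / 4)))%:E)%E.
Proof.
move=> mB w0 wB; set t := #|S|%:R * w / 4.
set X := fun x : n.-tuple T => \sum_(i < n | S i) \1_(B i) (tnth x i) : R.
have mX : measurable_fun [set: n.-tuple T] X.
  by apply: (measurable_sum_tnth S (f := fun i => \1_(B i))) => i; exact: measurable_indic.
have mA : measurable [set x | X x <= t].
  by rewrite -[X in measurable X]setTI; exact: measurable_fun_le.
have low := @ge0_integral_lower _ _ _ (tuple_prob P) [set x | X x <= t]
  (fun x => expR (- X x)) (expR (- t)) mA (expR_ge0 _) (fun=> expR_ge0 _).
have up : (\int[tuple_prob P]_x (expR (- X x))%:E <= (expR (- (2 * t)))%:E)%E.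
  pose f i (y : T) := (if S i then expR (- \1_(B i) y) else 1 : R)%:E.
  have -> : (\int[tuple_prob P]_x (expR (- X x))%:E =
      \int[tuple_prob P]_x \prod_(i < n) f i (tnth x i))%E.
    apply: eq_integral => x _.
    by rewrite /f prodEFin -big_mkcond /X -sumrN expR_sum.
  rewrite integral_tuple_prob_prod; last 2 first.
  - move=> i; rewrite /f; case: (S i); last exact: measurable_cst.
    apply/measurable_EFinP/measurableT_comp => //.
    by apply: measurableT_comp => //; exact: measurable_indic.
  - by move=> i y; rewrite /f lee_fin; case: (S i); rewrite ?expR_ge0.
  have -> : expR (- (2 * t)) = \prod_(i < n) (if S i then expR (- (w / 2)) else 1 : R).
    rewrite -big_mkcond -expR_sum sumr_const; congr expR; rewrite /t -mulr_natl.
    by field.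
  suff fi i : (\int[P i]_y f i y <= (if S i then expR (- (w / 2)) else 1)%:E)%E.
    rewrite -prodEFin.
    suff: (0 <= \prod_(i < n) \int[P i]_y f i y <=
           \prod_(i < n) (if S i then expR (- (w / 2)) else 1)%:E)%E by case/andP.
    apply: (big_ind2 (fun x y => 0 <= x <= y)%E) => [|a b a' b'|i _].
    - by rewrite lexx lee01.
    - by move=> /andP[a0 ab] /andP[a0' ab']; rewrite mule_ge0//= lee_pmul.
    - rewrite fi andbT; apply: integral_ge0 => y _.
      by rewrite /f lee_fin; case: (S i); rewrite ?expR_ge0.
  rewrite /f; case: (boolP (S i)) => Si; last first.
    by rewrite integral_cst// mul1e -[leRHS](probability_setT (P i)).
  have [b Pb] : exists b, P i (B i) = b%:E.
    by exists (fine (P i (B i))); rewrite fineK// fin_num_measure.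
  have Pb' : P i (~` B i) = (1 - b)%:E by rewrite probability_setC// Pb.
  (* Since e^(-1) <= 1/2, the integrand is at most 1/2 on [B i] and 1 off it. The integral is then
     at most 1 - b/2 <= 1 - w/2 <= e^(-w/2). *)
  apply: (@le_trans _ _ (\int[P i]_y (2^-1 * \1_(B i) y + \1_(~` B i) y)%:E)%E).
    apply: ge0_le_integral => //.
    - apply/measurable_EFinP/measurableT_comp => //.
      by apply: measurableT_comp => //; exact: measurable_indic.
    - apply/measurable_EFinP; apply: measurable_funD; last first.
        by apply: measurable_indic; exact: measurableC.
      by apply: measurable_funM => //; exact: measurable_indic.
    - move=> y _; rewrite lee_fin !indicE in_setC; case: (y \in B i) => /=.
        rewrite mulr1 addr0 expRN lef_pV2 ?posrE ?expR_gt0//.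
        by rewrite -[2]/(1 + 1) expR_ge1Dx.
      by rewrite oppr0 expR0 mulr0 add0r.
  have -> : (\int[P i]_y (2^-1 * \1_(B i) y + \1_(~` B i) y)%:E =
      (2^-1 * b + (1 - b))%:E)%E.
    under eq_integral do rewrite EFinD EFinM.
    have mC := measurableC (mB i).
    rewrite ge0_integralD//; last 2 first.
    - apply: emeasurable_funM => //.
      by apply/measurable_EFinP; exact: measurable_indic.
    - by apply/measurable_EFinP; exact: measurable_indic.
    rewrite ge0_integralZl//; last first.
      by apply/measurable_EFinP; exact: measurable_indic.
    have i1 : (\int[P i]_y (\1_(B i) y)%:E = b%:E)%E.
      by rewrite integral_indic// setIT; exact: Pb.
    have i2 : (\int[P i]_y (\1_(~` B i) y)%:E = (1 - b)%:E)%E.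
      by rewrite integral_indic// setIT; exact: Pb'.
    by rewrite i1 i2.
  rewrite lee_fin; apply: le_trans (expR_ge1Dx _).
  have := wB i Si; rewrite Pb lee_fin; lra.
(* Markov's inequality: e^(-t) times the probability is at most e^(-2t). *)
rewrite -(@lee_pmul2l _ (expR (- t))%:E)// ?lte_fin ?expR_gt0//.
rewrite -EFinM -expRD -opprD -mulr2n -mulr_natl; apply: le_trans up.
by apply: low => x /=; rewrite ler_expR lerN2.
Qed.

(** * Typical behaviour of the noise *)

Lemma expR1_ge2 (R : realType) : 2 <= expR (1 : R).
Proof. by rewrite -[2]/(1 + 1) expR_ge1Dx. Qed.

(** Only the interval from m + s sqrt q to m + s (sqrt q + 1) is kept. There x - m <= 2 s sqrt q, so
    the density is at least its peak times e^(-2q). *)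
Lemma normal_prob_tail_ge (R : realType) (m s q : R) : 0 < s -> 2 <= q ->
  ((expR (- (3 * q)))%:E <=
   normal_prob m s [set x | (Num.sqrt q <= (x - m) / s)%R])%E.
Proof.
move=> s0 q2; set A := [set x | _].
have q0 : 0 <= q by lra.
pose a := m + s * Num.sqrt q; set b := a + s.
have mA : measurable (A : set (measurableTypeR R)).
  rewrite -[X in measurable X]setTI; apply: measurable_fun_le => //.
  by apply: measurable_funM => //; exact: measurable_funB.
have mpdf D : measurable_fun (D : set (measurableTypeR R)) (fun x => (normal_pdf m s x)%:E).
  by apply/measurable_funTS/measurableT_comp => //; exact: measurable_normal_pdf.
have IA : `[a, b]%classic `<=` A.
  move=> x; rewrite /= in_itv/= => /andP[ax _]; rewrite /A/= ler_pdivlMr//.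
  by move: ax; rewrite /a; lra.
have ab : a < b by rewrite /b; lra.
rewrite /normal_prob.
apply: (@le_trans _ _ (\int[lebesgue_measure]_(x in `[a, b]) (normal_pdf m s x)%:E)%E); last first.
  by apply: ge0_subset_integral => //; move=> x _; rewrite lee_fin normal_pdf_ge0.
pose c := normal_peak s * expR (- (2 * q)).
apply: (@le_trans _ _ (\int[lebesgue_measure]_(x in `[a, b]) (cst c%:E) x)%E); last first.
  apply: ge0_le_integral => //.
  - by move=> x _; rewrite lee_fin mulr_ge0 ?expR_ge0 ?normal_peak_ge0.
  - move=> x; rewrite /= in_itv/= => /andP[ax xb].
    rewrite lee_fin normal_pdfE ?gt_eqF// /normal_fun /c.
    rewrite ler_wpM2l ?normal_peak_ge0// ler_expR mulNr lerN2.
    rewrite ler_pdivrMr; last by rewrite mulrn_wgt0// exprn_gt0.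
    have sq1 : 1 <= Num.sqrt q by rewrite -sqrtr1 ler_wsqrtr; lra.
    have sqq : Num.sqrt q ^+ 2 = q by rewrite sqr_sqrtr.
    have xm : x - m <= 2 * s * Num.sqrt q.
      by move: xb; rewrite /b /a; nra.
    have xm0 : 0 <= x - m by move: ax; rewrite /a; nra.
    apply: (@le_trans _ _ ((2 * s * Num.sqrt q) ^+ 2)).
      by rewrite lerXn2r ?nnegrE// mulr_ge0 ?sqrtr_ge0//; lra.
    by rewrite !exprMn sqq; lra.
rewrite integral_cst//= lebesgue_measure_itv/= lte_fin ab -EFinD -EFinM lee_fin.
have -> : b - a = s by rewrite /b; ring.
(* The spare factor e^(-q) absorbs s times the peak, which is 1 / sqrt(2 pi): indeed sqrt(2 pi) <= 3
   <= 1 + q <= e^q. *)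
rewrite /c mulrAC; have -> : - (3 * q) = - q - 2 * q by ring.
rewrite expRD ler_wpM2r ?expR_ge0//.
rewrite expRN /normal_peak mulrC ler_pdivlMr ?sqrtr_gt0; last first.
  by rewrite mulrn_wgt0// mulr_gt0 ?pi_gt0// exprn_gt0.
rewrite mulrC ler_pdivrMr ?expR_gt0//.
have := pihalf_lt2 R; have := pi_gt0 R => pi0 pi4.
apply: (@le_trans _ _ (Num.sqrt ((3 * s) ^+ 2))).
  apply: ler_wsqrtr; rewrite exprMn -mulr_natl.
  have : 0 <= s ^+ 2 by rewrite sqr_ge0.
  nra.
rewrite sqrtr_sqr gtr0_norm ?mulr_gt0// mulrC ler_pM2l//.
by apply: le_trans (expR_ge1Dx q); lra.
Qed.

Lemma card_ord_lt (n k : nat) : (k <= n)%N -> #|[pred i : 'I_n | (i < k)%N]| = k.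
Proof.
move=> kn; rewrite -sum1_card -[RHS]card_ord -sum1_card.
by rewrite [RHS](big_ord_widen n (fun=> 1%N)).
Qed.

Lemma card_ord_ge (n k : nat) : (k <= n)%N -> #|[pred i : 'I_n | (k <= i)%N]| = (n - k)%N.
Proof.
move=> kn; have := cardC [pred i : 'I_n | (i < k)%N].
rewrite card_ord_lt// card_ord => e; rewrite -[X in (X - _)%N]e addKn.
by apply: eq_card => i; rewrite !inE -leqNgt.
Qed.

Lemma sqrt2_le2 (R : realType) : Num.sqrt (2 : R) <= 2.
Proof.
by rewrite -[leRHS]ger0_norm// -sqrtr_sqr ler_wsqrtr// expr2; lra.
Qed.

Lemma sqr_le_expR (R : realType) (z : R) : z ^+ 2 <= 4 * expR (z ^+ 2 / 4).
Proof. by have := expR_ge1Dx (z ^+ 2 / 4); have := sqr_ge0 z; lra. Qed.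

(** With y = z^2 / (2q), the power |z|^q is (2q)^(q/2) y^(q/2), and y <= e^y. This bounds the q-th
    moment of the noise by the one exponential moment computed above. *)
Lemma powR_abs_le_expR (R : realType) (z q : R) : 0 < q ->
  `|z| `^ q <= (2 * q) `^ (q / 2) * expR (z ^+ 2 / 4).
Proof.
move=> q0; set y := z ^+ 2 / (2 * q).
have y0 : 0 <= y by rewrite divr_ge0 ?sqr_ge0//; lra.
have -> : `|z| `^ q = (2 * q) `^ (q / 2) * y `^ (q / 2).
  rewrite -powRM//; last by lra.
  have -> : 2 * q * y = `|z| ^+ 2 by rewrite real_normK ?num_real// /y; field; lra.
  by rewrite -powR_mulrn// -powRrM; congr powR; field.
rewrite ler_wpM2l ?powR_ge0//.
have -> : z ^+ 2 / 4 = y * (q / 2) by rewrite /y; field; lra.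
rewrite expRM ge0_ler_powR ?nnegrE ?expR_ge0//; first by lra.
by have := expR_ge1Dx y; lra.
Qed.

Section gauss_events.
Variables (R : realType) (d : nat) (theta : d.-tuple R) (s : R).
Hypothesis s0 : 0 < s.
Let z (i : 'I_d) (x : measurableTypeR R) : R := (x - tnth theta i) / s.

Let mz i : measurable_fun [set: measurableTypeR R] (z i).
Proof. by apply: measurable_funM => //; exact: measurable_funB. Qed.

Lemma integral_normal_prob_le (i : 'I_d) (f : R -> R) (K : R) :
  measurable_fun [set: R] f -> (forall x, 0 <= f x) -> 0 <= K ->
  (forall x, f x <= K * expR (x ^+ 2 / 4)) ->
  (\int[normal_prob (tnth theta i) s]_x (f (z i x))%:E <= (2 * K)%:E)%E.
Proof.
move=> mf f0 K0 fK.
have mE : measurable_fun [set: measurableTypeR R]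
    (fun x => (expR (z i x ^+ 2 / 4))%:E).
  apply/measurable_EFinP; apply: measurableT_comp => //.
  by apply: measurable_funM => //; exact: measurable_funX.
apply: (@le_trans _ _ (\int[normal_prob (tnth theta i) s]_x
    (K%:E * (expR (z i x ^+ 2 / 4))%:E))%E).
  apply: ge0_le_integral => //.
  - by move=> x _; rewrite lee_fin.
  - by apply/measurable_EFinP; apply: measurableT_comp (mz i).
  - exact: emeasurable_funM.
  - by move=> x _; rewrite -EFinM lee_fin.
rewrite ge0_integralZl//.
rewrite normal_prob_expR_sqr// -EFinM lee_fin mulrC ler_wpM2r//.
exact: sqrt2_le2.
Qed.

(** Markov's inequality: the sum has mean at most 2K |S|, where the 2 bounds the exponential moment
    sqrt 2, and 16 = 8 * 2 leaves probability 1/8. *)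
Lemma gauss_markov (S : pred 'I_d) (f : R -> R) (K t : R) :
  measurable_fun [set: R] f -> (forall x, 0 <= f x) -> 0 <= K ->
  (forall x, f x <= K * expR (x ^+ 2 / 4)) -> 0 < t ->
  #|S|%:R * (16 * K) <= t ->
  measurable [set y : d.-tuple (measurableTypeR R) |
    t <= \sum_(i < d | S i) f (z i (tnth y i))] /\
  (gauss theta s [set y | t <= \sum_(i < d | S i) f (z i (tnth y i))]%R <=
   (8^-1)%:E)%E.
Proof.
move=> mf f0 K0 fK t0 tK.
set X := fun y : d.-tuple (measurableTypeR R) => \sum_(i < d | S i) f (z i (tnth y i)).
have mfz i : measurable_fun [set: measurableTypeR R] (fun x => f (z i x)).
  exact: measurableT_comp (mz i).
have mX : measurable_fun [set: d.-tuple (measurableTypeR R)] X.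
  exact: (measurable_sum_tnth S (f := fun i x => f (z i x))).
have mA : measurable [set y | t <= X y].
  by rewrite -[X in measurable X]setTI; exact: measurable_fun_le.
split=> //; have X0 y : 0 <= X y by apply: sumr_ge0.
have low : (t%:E * gauss theta s [set y | (t <= X y)%R] <=
    \int[gauss theta s]_y (X y)%:E)%E.
  exact: ge0_integral_lower mA (ltW t0) X0 (fun y ty => ty).
have up := @integral_sum_tnth_le _ _ R d
  (fun i => normal_prob (tnth theta i) s) S (fun i x => f (z i x)) (2 * K) mfz
  (fun i x => f0 _) (fun i _ => integral_normal_prob_le i mf f0 K0 fK).
have {low up} := le_trans low up.
have [b ->] : exists b, gauss theta s [set y | t <= X y] = b%:E.
  by exists (fine (gauss theta s [set y | t <= X y])); rewrite fineK// fin_num_measure.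
rewrite -EFinM !lee_fin => tb.
rewrite -(ler_pM2l t0); apply: (le_trans tb); lra.
Qed.

(** Each of the three conditions fails with probability at most 1/8: Markov's inequality controls
    the two moments, Chernoff's bound the number of large coordinates off the support. *)
Lemma gauss_good_event (k : nat) (q : R) : 2 <= q -> (1 <= k)%N ->
  k%:R * expR (10 * q) <= d%:R ->
  exists2 A : set (d.-tuple (measurableTypeR R)),
    measurable A /\ ((2^-1)%:E <= gauss theta s A)%E &
    forall y, A y ->
    [/\ \sum_(i < d | (k <= i)%N) `|z i (tnth y i)| `^ q <=
          d%:R * (16 * (2 * q) `^ (q / 2)),
        \sum_(i < d | (i < k)%N) z i (tnth y i) ^+ 2 <= k%:R * 64 &
        d%:R * expR (- (5 * q)) <=
          \sum_(i < d | (k <= i)%N) (Num.sqrt q <= z i (tnth y i))%R%:R].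
Proof.
move=> q2 k1 kd.
have k1R : 1 <= k%:R :> R by rewrite ler1n.
have e10 : 1 + 10 * q <= expR (10 * q) by exact: expR_ge1Dx.
have kd2 : 2 * k%:R <= d%:R :> R by nra.
have kd' : (k <= d)%N by rewrite -(ler_nat R); lra.
have d1 : 1 <= d%:R :> R by lra.
pose w : R := expR (- (3 * q)).
pose S : pred 'I_d := [pred i : 'I_d | (k <= i)%N].
have cS : #|S|%:R = d%:R - k%:R :> R by rewrite card_ord_ge// natrB.
have q0 : 0 < q by lra.
have pq : 0 < (2 * q) `^ (q / 2) by apply: powR_gt0; lra.
have mpw : measurable_fun [set: R] (fun x : R => `|x| `^ q).
  by apply: (measurableT_comp (measurable_powR q)); exact: normr_measurable.
have [||m1 P1] := @gauss_markov S (fun x => `|x| `^ q) ((2 * q) `^ (q / 2))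
    (d%:R * (16 * (2 * q) `^ (q / 2))) mpw (fun=> powR_ge0 _ _) (ltW pq)
    (fun x => powR_abs_le_expR x q0).
- by rewrite !mulr_gt0//; lra.
- by rewrite ler_wpM2r ?mulr_ge0 ?powR_ge0// cS; lra.
have [||m2 P2] := @gauss_markov [pred i : 'I_d | (i < k)%N] (fun x => x ^+ 2) 4
    (k%:R * 64) (measurable_funX _ (@measurable_id _ _ _)) (fun=> sqr_ge0 _)
    ltac:(lra) (@sqr_le_expR R).
- by lra.
- by rewrite card_ord_lt//; lra.
pose B (i : 'I_d) : set (measurableTypeR R) := [set x | Num.sqrt q <= z i x].
have mB i : measurable (B i).
  by rewrite -[X in measurable X]setTI; exact: measurable_fun_le.
have P3 := @tuple_prob_count_tail _ _ R d
  (fun i => normal_prob (tnth theta i) s) S B w mB (expR_ge0 _)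
  (fun i _ => normal_prob_tail_ge _ s0 q2).
set A1 := [set y | _] in m1 P1; set A2 := [set y | _] in m2 P2.
set A3 := [set y | _] in P3.
have m3 : measurable A3.
  rewrite -[X in measurable X]setTI; apply: measurable_fun_le => //.
  by apply: (measurable_sum_tnth S (f := fun i => \1_(B i))) => i; exact: measurable_indic.
(* Here |S| = d - k >= d/2 and w = e^(-3q), so the factor e^(-2q) <= 1/8 covers the loss. *)
have low : d%:R * expR (- (5 * q)) <= #|S|%:R * w / 4.
  have : 4 * expR (- (5 * q)) <= w / 2.
    have -> : - (5 * q) = - (3 * q) + - (2 * q) by ring.
    rewrite expRD -/w mulrCA ler_wpM2l ?expR_ge0//.
    rewrite expRN ler_pdivrMr ?expR_gt0//.
    have -> : 2 * q = q + q by ring.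
    rewrite expRD; have := expR_ge1Dx q; nra.
  have := expR_gt0 (- (5 * q)); have := expR_gt0 (- (3 * q)); rewrite -/w cS; nra.
(* As d >= e^(10q), the Chernoff exponent is at least d e^(-5q) >= e^(5q) >= 11, more than enough
   for 1/8. *)
have {}P3 : (gauss theta s A3 <= (8^-1)%:E)%E.
  apply: (le_trans P3); rewrite lee_fin expRN lef_pV2 ?posrE ?expR_gt0//.
  apply: le_trans (expR_ge1Dx _); rewrite -lerBlDl; apply: le_trans low.
  rewrite -(ler_pM2r (expR_gt0 (5 * q))) -mulrA -expRD addNr expR0 mulr1.
  have : expR (10 * q) = expR (5 * q) * expR (5 * q) by rewrite -expRD; congr expR; ring.
  have := expR_ge1Dx (5 * q); nra.
pose A := A1 `|` A2 `|` A3.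
have mA : measurable A by apply: measurableU => //; exact: measurableU.
exists (~` A).
  split; first exact: measurableC.
  rewrite probability_setC//.
  have : (gauss theta s A <= (8^-1)%:E + (8^-1)%:E + (8^-1)%:E)%E.
    apply: (le_trans (measureU2 _ _ _)) => //; first exact: measurableU.
    apply: leeD => //; apply: (le_trans (measureU2 _ _ _)) => //.
    exact: leeD.
  have [b ->] : exists b, gauss theta s A = b%:E.
    by exists (fine (gauss theta s A)); rewrite fineK// fin_num_measure.
  by rewrite -!EFinD !lee_fin; lra.
move=> y /= Ay; have [y1 [y2 y3]] : ~ A1 y /\ ~ A2 y /\ ~ A3 y.
  by split; [|split]; apply: contra_not Ay => ?; [left; left|left; right|right].
move: y1 y2 y3 => /negP + /negP + /negP.
rewrite -!ltNge => y1 y2 y3; split; [exact: ltW|exact: ltW|].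
apply: (le_trans low); apply: (le_trans (ltW y3)); rewrite le_eqVlt; apply/orP; left.
by apply/eqP; apply: eq_bigr => i _; rewrite indicE /B mem_setE.
Qed.

End gauss_events.

(** * A minimizer cannot stay close to a sparse vertex *)

(* r n^(-1/p) is the common value of n equal entries of a vector of l_p norm r. *)
Section spread.
Variables (R : realType) (n r p : R).
Hypotheses (n0 : 0 < n) (r0 : 0 < r) (p0 : 0 < p).

Lemma spread_l1 (q : R) : p^-1 + q^-1 = 1 ->
  n * (r * n `^ (- p^-1)) = r * n `^ q^-1.
Proof.
move=> pq; rewrite mulrCA; congr (_ * _).
have -> : q^-1 = 1 + - p^-1 by rewrite -pq; ring.
by rewrite powRD ?powRr1 ?(ltW n0)//; apply/implyP => _; rewrite gt_eqF.
Qed.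

Lemma spread_l2 : n * (r * n `^ (- p^-1)) ^+ 2 = r ^+ 2 * n `^ (1 - 2 / p).
Proof.
rewrite exprMn mulrCA; congr (_ * _).
have -> : 1 - 2 / p = 1 + (- p^-1 + - p^-1) by ring.
rewrite powRD ?powRr1 ?(ltW n0)//; last by apply/implyP => _; rewrite gt_eqF.
by rewrite powRD ?expr2//; apply/implyP => _; rewrite gt_eqF.
Qed.

Lemma spread_lp : n * (r * n `^ (- p^-1)) `^ p = r `^ p.
Proof.
rewrite powRM ?powR_ge0// ?(ltW r0)// mulrCA -powRrM mulNr mulVf ?gt_eqF//.
by rewrite powRN powRr1 ?(ltW n0)// divff ?mulr1// gt_eqF.
Qed.

End spread.

Lemma conjugate_gt1 (R : realType) (p q : R) : 1 < p -> p^-1 + q^-1 = 1 -> 0 < q.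
Proof.
move=> p1 pq; rewrite -invr_gt0.
have : p^-1 < 1 by rewrite invf_lt1//; lra.
lra.
Qed.

(* Tangent line of x |-> x `^ p at a, by Young's inequality. *)
Lemma powR_tangent (R : realType) (p a h : R) : 1 < p -> 0 < a ->
  a `^ p - p * a `^ p / a * `|h| <= `|a + h| `^ p.
Proof.
move=> p1 a0; have p0 : 0 < p by lra.
have pq : p^-1 + (p / (p - 1))^-1 = 1 by field; lra.
have q0 := conjugate_gt1 p1 pq.
(* With second factor 1, Young's inequality reads p u <= u^p + p - 1, here at u = |1 + h/a|. *)
have := conjugate_powR (normr_ge0 (1 + h / a)) (@ler01 R) p0 q0 pq.
rewrite powR1 mulr1 => young.
have -> : a + h = a * (1 + h / a) by field; rewrite gt_eqF.
rewrite normrM powRM// gtr0_norm//.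
have ap : 0 < a `^ p by rewrite powR_gt0.
have t1 : 1 - `|h| / a <= `|1 + h / a|.
  have -> : `|h| / a = `|h / a| by rewrite normrM normfV (gtr0_norm a0).
  by have := lerB_dist 1 (- (h / a)); rewrite normr1 normrN opprK.
have t2 : 1 - p * (`|h| / a) <= `|1 + h / a| `^ p.
  have : p * `|1 + h / a| <= `|1 + h / a| `^ p + (p - 1).
    have -> : `|1 + h / a| `^ p + (p - 1) =
      p * (`|1 + h / a| `^ p / p + 1 / (p / (p - 1))) by field; lra.
    by rewrite ler_pM2l.
  nra.
have -> : a `^ p - p * a `^ p / a * `|h| = a `^ p * (1 - p * (`|h| / a)) by field; rewrite gt_eqF.
by rewrite ler_pM2l.
Qed.

Lemma powR_div (R : realType) (a b q : R) : 0 <= a -> 0 < b ->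
  (a / b) `^ q = a `^ q / b `^ q.
Proof.
move=> a0 b0; rewrite powRM ?invr_ge0 ?(ltW b0)//; congr (_ * _).
by rewrite -[b^-1]powR_inv1 ?(ltW b0)// powRAC powR_inv1 ?powR_ge0.
Qed.

(* Hoelder's inequality in the form obtained by summing Young's inequality. *)
Lemma sum_mul_le_young (R : realType) (I : finType) (S : pred I) (p q G H : R)
    (g t : I -> R) :
  0 < p -> 0 < q -> p^-1 + q^-1 = 1 -> 0 < G -> 0 < H ->
  \sum_(i | S i) `|g i| `^ q <= G `^ q -> \sum_(i | S i) `|t i| `^ p <= H `^ p ->
  \sum_(i | S i) g i * t i <= G * H.
Proof.
move=> p0 q0 pq G0 H0 gG tH.
have Gq : 0 < G `^ q by rewrite powR_gt0.
have Hp : 0 < H `^ p by rewrite powR_gt0.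
apply: (@le_trans _ _ (\sum_(i | S i) G * H *
    (`|g i| `^ q / G `^ q / q + `|t i| `^ p / H `^ p / p))).
  apply: ler_sum => i _; apply: (le_trans (ler_norm _)); rewrite normrM.
  have -> : `|g i| * `|t i| = G * H * ((`|g i| / G) * (`|t i| / H)).
    by field; rewrite !gt_eqF.
  rewrite ler_pM2l ?mulr_gt0//.
  rewrite -!powR_div//.
  by apply: conjugate_powR => //; rewrite ?divr_ge0 ?(ltW G0) ?(ltW H0)// addrC.
rewrite -mulr_sumr -[leRHS]mulr1 ler_pM2l ?mulr_gt0// big_split/=.
rewrite -!mulr_suml -[leRHS]pq addrC lerD//.
  by rewrite ler_piMl ?invr_ge0 ?(ltW p0)// ler_pdivrMr// mul1r.
by rewrite ler_piMl ?invr_ge0 ?(ltW q0)// ler_pdivrMr// mul1r.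
Qed.

(* The constants of [minimizer_far_from_sparse] are tuned for this numerical inequality. *)
Lemma expR_numeric (R : realType) :
  16 * expR (- 10) + 7 * expR (- 9) < expR (- 5) :> R.
Proof.
have e2 := expR1_ge2 R; set e := expR 1 in e2.
have e5 : 0 < expR (- 10) :> R by exact: expR_gt0.
have -> : expR (- 9) = e * expR (- 10) :> R by rewrite -expRD; congr expR; ring.
have -> : expR (- 5) = e ^+ 5 * expR (- 10) :> R.
  by rewrite -expRM_natl -expRD; congr expR; ring.
rewrite mulrA -mulrDl ltr_pM2r//.
have e4 : 16 <= e ^+ 4.
  have e22 : 4 <= e ^+ 2 by nra.
  rewrite (_ : e ^+ 4 = e ^+ 2 * e ^+ 2); last by ring.
  by nra.
by rewrite exprSr; nra.
Qed.

(** By contradiction: if [t] were within c |theta| of theta, where c = e^(-20) is the square root of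
    the constant in the conclusion, then the competitor [v] would be strictly closer to theta + s g
    than [t]. Here Q = sqrt q d^(1/q), and everything is compared with s r Q. *)
Lemma minimizer_far_from_sparse (R : realType) (d k : nat) (p q r s : R)
    (g t : 'I_d -> R) (a := r * k%:R `^ (- p^-1))
    (theta := fun i : 'I_d => if (i < k)%N then a else 0) :
  1 < p -> p < 2 -> p^-1 + q^-1 = 1 ->
  (1 <= k)%N -> k%:R * expR (10 * q) <= d%:R -> 0 < r -> 0 < s ->
  r * k%:R `^ (1 - 2 / p) <= expR (- 9) * (s * (Num.sqrt q * d%:R `^ q^-1)) ->
  \sum_(i < d | (k <= i)%N) `|g i| `^ q <= d%:R * (16 * (2 * q) `^ (q / 2)) ->
  \sum_(i < d | (i < k)%N) g i ^+ 2 <= k%:R * 64 ->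
  d%:R * expR (- (5 * q)) <=
    \sum_(i < d | (k <= i)%N) (Num.sqrt q <= g i)%R%:R ->
  \sum_(i < d) `|t i| `^ p <= r `^ p ->
  (forall v : 'I_d -> R, \sum_(i < d) `|v i| `^ p <= r `^ p ->
    \sum_(i < d) (t i - (theta i + s * g i)) ^+ 2 <=
    \sum_(i < d) (v i - (theta i + s * g i)) ^+ 2) ->
  expR (- 40) * (r ^+ 2 * k%:R `^ (1 - 2 / p)) <=
    \sum_(i < d) (t i - theta i) ^+ 2.
Proof.
move=> p1 p2 pq k1 kd r0 s0 rs gq g2 gN tball tmin.
rewrite leNgt; apply/negP => D.
have p0 : 0 < p by lra.
have q0 := conjugate_gt1 p1 pq.
have q2 : 2 <= q.
  have : 2^-1 < p^-1 by rewrite ltf_pV2 ?posrE//; lra.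
  have qi : q^-1 * q = 1 by rewrite mulVf ?gt_eqF.
  by move=> ph; have : 0 < (2^-1 - q^-1) * q; [rewrite mulr_gt0//; lra|lra].
have k0 : 0 < k%:R :> R by rewrite ltr0n.
have a0 : 0 < a by rewrite mulr_gt0// powR_gt0.
have ka : k%:R * a = r * k%:R `^ q^-1 by exact: spread_l1.
have ka2 : k%:R * a ^+ 2 = r ^+ 2 * k%:R `^ (1 - 2 / p) by exact: spread_l2.
have kap : k%:R * a `^ p = r `^ p by exact: spread_lp.
rewrite -ka2 in D.
have d0 : 0 < d%:R :> R by apply: lt_le_trans kd; rewrite mulr_gt0 ?expR_gt0.
set Q := Num.sqrt q * d%:R `^ q^-1 in rs.
have sq1 : 1 <= Num.sqrt q by rewrite -sqrtr1 ler_wsqrtr; lra.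
have Q0 : 0 < Q by rewrite mulr_gt0 ?powR_gt0//; lra.
have kd' : (k <= d)%N.
  rewrite -(ler_nat R); apply: le_trans kd; rewrite ler_peMr ?(ltW k0)//.
  by rewrite -[leLHS]expR0 ler_expR; lra.
have cS : #|[pred i : 'I_d | (i < k)%N]| = k by rewrite card_ord_lt.
have sumS (x : R) : \sum_(i < d | (i < k)%N) x = k%:R * x.
  by rewrite sumr_const cS mulr_natl.
have splitS (f : 'I_d -> R) : \sum_(i < d) f i =
    \sum_(i < d | (i < k)%N) f i + \sum_(i < d | (k <= i)%N) f i.
  by rewrite (bigID (fun i : 'I_d => (i < k)%N))/=; congr (_ + _);
    apply: eq_bigl => i; rewrite -leqNgt.
have DS : \sum_(i < d | (i < k)%N) (t i - a) ^+ 2 <= \sum_(i < d) (t i - theta i) ^+ 2.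
  rewrite splitS -[leLHS]addr0 lerD//; last by apply: sumr_ge0 => i _; exact: sqr_ge0.
  by apply: ler_sum => i ik; rewrite /theta ik.
set c : R := expR (- 20).
have c0 : 0 < c by rewrite expR_gt0.
have cc : expR (- 40) = c ^+ 2.
  by rewrite expr2 -expRD; congr expR; ring.
rewrite cc in D.
have c1 : c < 1 by rewrite -[ltRHS]expR0 ltr_expR; lra.
have {}D : \sum_(i < d | (i < k)%N) (t i - a) ^+ 2 <= c ^+ 2 * (k%:R * a ^+ 2).
  exact: le_trans DS (ltW D).
have ka2_gt0 : 0 < k%:R * a ^+ 2 by rewrite mulr_gt0 ?exprn_gt0.
(* The square identity below encodes g t <= (a/8) g^2 + (2/a) t^2 together with t^2 <= 2 ((t - a)^2
   + a^2); each of the two sums then contributes at most 8 k a. *)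
have step1 : \sum_(i < d | (i < k)%N) g i * t i <= 16 * (k%:R * a).
  apply: (@le_trans _ _ (\sum_(i < d | (i < k)%N)
      (a / 8 * g i ^+ 2 + 4 / a * ((t i - a) ^+ 2 + a ^+ 2)))).
    apply: ler_sum => i _; rewrite -subr_ge0.
    have -> : a / 8 * g i ^+ 2 + 4 / a * ((t i - a) ^+ 2 + a ^+ 2) - g i * t i =
      a / 8 * (g i - 4 / a * t i) ^+ 2 + 2 / a * (t i - 2 * a) ^+ 2.
      by field; rewrite gt_eqF.
    by rewrite addr_ge0// mulr_ge0 ?sqr_ge0// divr_ge0// ltW.
  rewrite big_split/= -!mulr_sumr big_split/= sumS.
  apply: (@le_trans _ _ (a / 8 * (k%:R * 64) + 4 / a * (2 * (k%:R * a ^+ 2)))).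
    rewrite lerD//; first by rewrite ler_pM2l// divr_gt0.
    rewrite ler_pM2l ?divr_gt0//.
    have : c ^+ 2 * (k%:R * a ^+ 2) <= k%:R * a ^+ 2.
      by rewrite ler_piMl ?(ltW ka2_gt0)// exprn_ile1// ltW.
    lra.
  by rewrite le_eqVlt; apply/orP; left; apply/eqP; field; rewrite gt_eqF.
(* Cauchy-Schwarz, done termwise as x <= x^2 / (2ca) + ca/2. *)
have step2 : \sum_(i < d | (i < k)%N) `|t i - a| <= c * (k%:R * a).
  apply: (@le_trans _ _ (\sum_(i < d | (i < k)%N)
      ((2 * c * a)^-1 * (t i - a) ^+ 2 + c * a / 2))).
    apply: ler_sum => i _; rewrite -real_normK ?num_real// -subr_ge0.
    set x := `|_|.
    have -> : (2 * c * a)^-1 * x ^+ 2 + c * a / 2 - x = (2 * c * a)^-1 * (x - c * a) ^+ 2.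
      by field; rewrite !gt_eqF.
    by apply: mulr_ge0; [rewrite invr_ge0 ltW//; apply: mulr_gt0 => //; apply: mulr_gt0|exact: sqr_ge0].
  rewrite big_split/= -mulr_sumr sumS.
  apply: (@le_trans _ _ ((2 * c * a)^-1 * (c ^+ 2 * (k%:R * a ^+ 2)) + k%:R * (c * a / 2))).
    by rewrite lerD2r ler_pM2l// invr_gt0; apply: mulr_gt0 => //; apply: mulr_gt0.
  by rewrite le_eqVlt; apply/orP; left; apply/eqP; field; rewrite !gt_eqF.
have rp : 0 < r `^ p by rewrite powR_gt0.
(* Summing the tangent lines at a, the support keeps at least (1 - p c) r^p of the budget, and p <
   2. *)
have step2' : (1 - 2 * c) * r `^ p <= \sum_(i < d | (i < k)%N) `|t i| `^ p.
  apply: (@le_trans _ _ (\sum_(i < d | (i < k)%N)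
      (a `^ p - p * a `^ p / a * `|t i - a|))); last first.
    by apply: ler_sum => i _; have := powR_tangent (t i - a) p1 a0; rewrite subrKC.
  rewrite sumrB sumS -mulr_sumr kap.
  have : p * a `^ p / a * \sum_(i < d | (i < k)%N) `|t i - a| <= p * a `^ p / a * (c * (k%:R * a)).
    by rewrite ler_pM2l// !mulr_gt0 ?powR_gt0 ?invr_gt0.
  have -> : p * a `^ p / a * (c * (k%:R * a)) = p * c * (k%:R * a `^ p) by field; rewrite gt_eqF.
  have : 0 < c * r `^ p by rewrite mulr_gt0.
  rewrite kap; clear -p2; nra.
(* What remains off the support is at most 2c r^p, and 2c <= e^(-19) <= e^(-9p) because p < 2. *)
have {step2'}step3 : \sum_(i < d | (k <= i)%N) `|t i| `^ p <= (expR (- 9) * r) `^ p.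
  apply: (@le_trans _ _ (2 * c * r `^ p)).
    by move: tball; rewrite splitS; clear -step2'; lra.
  rewrite powRM ?expR_ge0 ?(ltW r0)// ler_pM2r// -expRM.
  apply: (@le_trans _ _ (expR 1 * c)); first by rewrite ler_pM2r// expR1_ge2.
  by rewrite -expRD ler_expR; clear -p2; lra.
(* Hoelder's inequality. The constant 6 comes from 6^q q^(q/2) = 18^(q/2) (2q)^(q/2), where 18^(q/2)
   >= 18 >= 16 because q >= 2. *)
have step4 : \sum_(i < d | (k <= i)%N) g i * t i <= (6 * Q) * (expR (- 9) * r).
  have G0 : 0 < 6 * Q by apply: mulr_gt0.
  have H0 : 0 < expR (- 9) * r by apply: mulr_gt0 => //; exact: expR_gt0.
  apply: (sum_mul_le_young p0 q0 pq G0 H0 _ step3).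
  have -> : (6 * Q) `^ q = d%:R * (6 `^ q * Num.sqrt q `^ q).
    rewrite /Q !powRM ?mulr_ge0 ?sqrtr_ge0 ?powR_ge0// -powRrM mulVf ?gt_eqF//.
    by rewrite powRr1 ?(ltW d0)//; ring.
  apply: (le_trans gq); rewrite ler_pM2l//.
  have -> : 6 `^ q * Num.sqrt q `^ q = 18 `^ (q / 2) * (2 * q) `^ (q / 2).
    rewrite -!powRM ?sqrtr_ge0//; last by lra.
    have -> : 18 * (2 * q) = (6 * Num.sqrt q) `^ 2.
      by rewrite powR_mulrn ?mulr_ge0 ?sqrtr_ge0// exprMn sqr_sqrtr; [ring|lra].
    by rewrite -powRrM; congr powR; field.
  rewrite ler_pM2r ?powR_gt0//; last by lra.
  apply: (@le_trans _ _ (18 `^ 1)); first by rewrite powRr1//; clear; lra.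
  by rewrite ler_powR//; clear -q2; lra.
(* The competitor [v] is constant on [T] and uses the whole budget; [N] is the size of [T]. *)
pose T (i : 'I_d) := (k <= i)%N && (Num.sqrt q <= g i)%R.
set N : R := \sum_(i < d | _) _ in gN.
have NT : N = \sum_(i < d | T i) 1.
  by rewrite /N /T [RHS]big_mkcondr/=; apply: eq_bigr => i _; case: ifP.
have sumT (x : R) : \sum_(i < d | T i) x = N * x.
  by rewrite NT mulr_suml; under [RHS]eq_bigr do rewrite mul1r.
have N0 : 0 < N by apply: lt_le_trans gN; rewrite mulr_gt0 ?expR_gt0.
(* With at least k equal entries, [v] is no longer than theta, since the exponent 1 - 2/p is
   negative. *)
have kN : k%:R <= N.
  apply: le_trans gN; rewrite expRN ler_pdivlMr ?expR_gt0//.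
  by apply: le_trans kd; rewrite ler_pM2l// ler_expR; clear -q0; lra.
pose b := r * N `^ (- p^-1).
have b0 : 0 < b by rewrite mulr_gt0// powR_gt0.
have Nb : N * b = r * N `^ q^-1 by exact: spread_l1.
have Nb2 : N * b ^+ 2 = r ^+ 2 * N `^ (1 - 2 / p) by exact: spread_l2.
have Nbp : N * b `^ p = r `^ p by exact: spread_lp.
pose v (i : 'I_d) := if T i then b else 0.
have vp : \sum_(i < d) `|v i| `^ p <= r `^ p.
  rewrite -Nbp -sumT [leRHS]big_mkcond/=; apply: ler_sum => i _; rewrite /v.
  by case: ifP => _; rewrite ?normr0 ?powR0 ?gt_eqF// gtr0_norm.
have v2 : \sum_(i < d) v i ^+ 2 = N * b ^+ 2.
  rewrite -sumT [RHS]big_mkcond/=; apply: eq_bigr => i _; rewrite /v.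
  by case: ifP => _ //; rewrite expr0n.
have th2 : \sum_(i < d) theta i ^+ 2 = k%:R * a ^+ 2.
  rewrite -sumS [RHS]big_mkcond/=; apply: eq_bigr => i _; rewrite /theta.
  by case: ifP => _ //; rewrite expr0n.
have vth i : v i * theta i = 0.
  by rewrite /v /T /theta ltnNge; case: leqP => _ /=; rewrite ?mulr0 ?mul0r.
have gv : r * Q * expR (- 5) <= \sum_(i < d) g i * v i.
  apply: (@le_trans _ _ (Num.sqrt q * (N * b))).
    rewrite Nb [leRHS]mulrCA.
    rewrite [leLHS](_ : _ = r * (Num.sqrt q * (d%:R `^ q^-1 * expR (- 5)))); last first.
      by rewrite /Q !mulrA.
    rewrite ler_pM2l// ler_pM2l ?(lt_le_trans ltr01 sq1)//.
    have -> : d%:R `^ q^-1 * expR (- 5) = (d%:R * expR (- (5 * q))) `^ q^-1.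
      rewrite powRM ?expR_ge0 ?(ltW d0)// -expRM; congr (_ * expR _).
      by field; rewrite gt_eqF.
    by rewrite ge0_ler_powR ?nnegrE ?invr_ge0 ?(ltW q0) ?(ltW N0)// mulr_ge0 ?expR_ge0.
  rewrite -sumT mulr_sumr [leLHS]big_mkcond/=; apply: ler_sum => i _; rewrite /v /T.
  case: ifP => [/andP[_ sg]|_]; last by rewrite mulr0.
  by rewrite ler_pM2r.
(* Expanding both squares, the terms |s g|^2 and 2 s <g, theta> cancel and <v, theta> vanishes. This
   leaves 2 s <g, v - t> <= |v|^2 + |theta|^2 - |t - theta|^2, whose right side is at most 2 e^(-9)
   s r Q. *)
have := tmin _ vp.
have -> : \sum_(i < d) (t i - (theta i + s * g i)) ^+ 2 =
    \sum_(i < d) (t i - theta i) ^+ 2 + \sum_(i < d) (s * g i) ^+ 2 +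
    2 * s * \sum_(i < d) g i * theta i - 2 * s * \sum_(i < d) g i * t i.
  by rewrite !mulr_sumr -!big_split/= -sumrB; apply: eq_bigr => i _; ring.
have -> : \sum_(i < d) (v i - (theta i + s * g i)) ^+ 2 =
    \sum_(i < d) v i ^+ 2 + \sum_(i < d) theta i ^+ 2 + \sum_(i < d) (s * g i) ^+ 2 +
    2 * s * \sum_(i < d) g i * theta i - 2 * s * \sum_(i < d) g i * v i.
  rewrite !mulr_sumr -!big_split/= -sumrB; apply: eq_bigr => i _.
  by transitivity (v i ^+ 2 + theta i ^+ 2 + (s * g i) ^+ 2 + 2 * s * (g i * theta i) -
    2 * s * (g i * v i) - 2 * (v i * theta i)); [ring|rewrite vth; ring].
rewrite v2 th2 Nb2 ka2 [\sum_(i < d) g i * t i]splitS.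
have h0 : 0 <= \sum_(i < d) (t i - theta i) ^+ 2 by apply: sumr_ge0 => i _; exact: sqr_ge0.
have Nk : r ^+ 2 * N `^ (1 - 2 / p) <= r ^+ 2 * k%:R `^ (1 - 2 / p).
  rewrite ler_pM2l ?exprn_gt0//.
  have -> : 1 - 2 / p = - (2 / p - 1) by ring.
  rewrite !powRN lef_pV2 ?posrE ?powR_gt0// ge0_ler_powR ?nnegrE ?(ltW k0) ?(ltW N0)//.
  by rewrite subr_ge0 ler_pdivlMr// mul1r ltW.
have rk : r ^+ 2 * k%:R `^ (1 - 2 / p) <= expR (- 9) * (s * r * Q).
  rewrite expr2 -mulrA; move: rs; rewrite -(ler_pM2l r0) => /le_trans; apply.
  by rewrite le_eqVlt; apply/orP; left; apply/eqP; ring.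
have kq : k%:R `^ q^-1 <= Q * expR (- 10).
  rewrite expRN ler_pdivlMr ?expR_gt0//.
  have -> : expR 10 = expR (10 * q) `^ q^-1 :> R.
    by rewrite -expRM; congr expR; field; rewrite gt_eqF.
  rewrite -powRM ?expR_ge0 ?(ltW k0)//.
  apply: (@le_trans _ _ (d%:R `^ q^-1)).
    by rewrite ge0_ler_powR ?nnegrE ?invr_ge0 ?(ltW q0) ?(ltW d0)// mulr_ge0 ?expR_ge0 ?(ltW k0).
  by rewrite ler_peMl ?powR_ge0.
move=> main.
have step1' : \sum_(i < d | (i < k)%N) g i * t i <= 16 * (r * (Q * expR (- 10))).
  by apply: (le_trans step1); rewrite ka !ler_pM2l.
have X0 : 0 < s * r * Q by apply: mulr_gt0 => //; exact: mulr_gt0.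
have enum := expR_numeric R.
set e := expR (- 5) in enum gv *; set e9 := expR (- 9) in enum step4 rk.
set e10 := expR (- 10) in enum step1'.
have {gv} gv : s * (r * Q * e) <= s * \sum_(i < d) g i * v i by rewrite ler_pM2l.
have {}step1' : s * \sum_(i < d | (i < k)%N) g i * t i <= s * (16 * (r * (Q * e10))) by rewrite ler_pM2l.
have {}step4 : s * \sum_(i < d | (k <= i)%N) g i * t i <= s * (6 * Q * (e9 * r)) by rewrite ler_pM2l.
have : (s * r * Q) * e <= (s * r * Q) * (16 * e10 + 7 * e9).
  clear -main h0 Nk rk gv step1' step4; lra.
by rewrite ler_pM2l// leNgt enum.
Qed.

(** * The risk of the MLE *)

Lemma lp_ballP (R : realType) (d : nat) (p r : R) (x : d.-tuple R) :
  0 < p -> 0 <= r ->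
  lp_ball d p r x <-> \sum_(i < d) `|tnth x i| `^ p <= r `^ p.
Proof.
move=> p0 r0; rewrite /lp_ball/= /lp_norm.
set X := \sum_(i < d) _; have X0 : 0 <= X by apply: sumr_ge0 => i _; exact: powR_ge0.
have pV : (r `^ p) `^ p^-1 = r by rewrite -powRrM divff ?gt_eqF// powRr1.
have XV : (X `^ p^-1) `^ p = X by rewrite -powRrM mulVf ?gt_eqF// powRr1.
split=> h.
- by rewrite -XV ge0_ler_powR ?nnegrE ?powR_ge0 ?(ltW p0).
- by rewrite -pV ge0_ler_powR ?nnegrE ?powR_ge0 ?invr_ge0 ?(ltW p0).
Qed.

(** Away from 0 the power is differentiable; at 0 one uses |y|^p <= |y| for |y| < 1. *)
Lemma continuous_powR_norm (R : realType) (p : R) : 1 < p ->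
  continuous (fun x : R => `|x| `^ p).
Proof.
move=> p1 x; have p0 : 0 < p by lra.
have [->|x0] := eqVneq x 0.
  rewrite /continuous_at normr0 powR0 ?gt_eqF//.
  apply/cvgrPdist_lt => e e0; near=> y.
  rewrite sub0r normrN ger0_norm ?powR_ge0//.
  have y1 : `|y| < 1 by near: y; exact: (@nbhs0_lt _ R^o).
  have ye : `|y| < e by near: y; exact: (@nbhs0_lt _ R^o).
  have [->|y0] := eqVneq y 0; first by rewrite normr0 powR0 ?gt_eqF.
  apply: le_lt_trans ye; apply: ge1r_powR; last exact: ltW.
  by rewrite normr_gt0 y0 ltW.
apply: (@continuous_comp _ _ _ (fun x : R => `|x|) (fun x => x `^ p)).
  exact: norm_continuous.
apply: differentiable_continuous; apply/derivable1_diffP; apply: derivable_powR.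
by rewrite in_itv/= andbT normr_gt0.
Unshelve. all: by end_near. Qed.

(** The set from which [xget] chooses is inhabited: read in row vectors, the ball is closed and
    bounded, hence compact, and the squared distance attains its minimum on it. *)
Lemma euclid_projP (R : realType) (d : nat) (p r : R) (y : d.-tuple R) :
  1 < p -> 0 <= r ->
  lp_ball d p r (euclid_proj (lp_ball d p r) y) /\
  forall u, lp_ball d p r u ->
    sqdist (euclid_proj (lp_ball d p r) y) y <= sqdist u y.
Proof.
move=> p1 r0; have p0 : 0 < p by lra.
apply: (xgetPex y (P := [set t | lp_ball d p r t /\ forall u, lp_ball d p r u -> sqdist t y <= sqdist u y])).
pose A := [set v : 'rV[R]_d | \sum_(i < d) `|v 0 i| `^ p <= r `^ p].
have csum (F : 'I_d -> 'rV[R]_d -> R) : (forall i, continuous (F i)) ->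
    continuous (fun v => \sum_(i < d) F i v).
  by move=> cF; apply: continuous_big => //; exact: add_continuous.
have A0 : A !=set0.
  exists 0; rewrite /A/= big1 ?powR_ge0// => i _.
  by rewrite mxE normr0 powR0// gt_eqF.
have cA : compact A.
  apply: bounded_closed_compact.
    exists r; split; first exact: num_real.
    move=> M rM v Av; rewrite /Num.norm/= mx_normrE.
    apply: bigmax_le => [|[i j] _ /=]; first by rewrite (le_trans r0)// ltW.
    apply: (le_trans _ (ltW rM)); rewrite ord1.
    have : `|v 0 j| `^ p <= r `^ p.
      apply: le_trans Av; rewrite (bigD1 j)//= lerDl; apply: sumr_ge0 => ? _.
      exact: powR_ge0.
    apply: contraTT; rewrite -!ltNge => rv.
    by rewrite gt0_ltr_powR ?nnegrE.
  apply: (@preimage_closed _ _ (fun v : 'rV[R]_d => \sum_(i < d) `|v 0 i| `^ p) [set x | x <= r `^ p]).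
    move=> v _; apply: csum => i w.
    apply: (@continuous_comp _ _ _ (fun w : 'rV[R]_d => w 0 i) (fun x => `|x| `^ p)).
      exact: coord_continuous.
    exact: continuous_powR_norm.
  exact: closed_le.
have cf : {within A, continuous (fun v : 'rV[R]_d =>
    \sum_(i < d) (v 0 i - tnth y i) ^+ 2)}.
  apply: continuous_subspaceT; apply: csum => i v.
  apply: (@continuous_comp _ _ _ (fun w : 'rV[R]_d => w 0 i) (fun x => (x - tnth y i) ^+ 2)).
    exact: coord_continuous.
  apply: (@continuous_comp _ _ _ (fun x : R => x - tnth y i) (fun x => x ^+ 2)).
    by apply: (@cvgB _ R^o) => //; exact: cvg_cst.
  exact: exprn_continuous.
have [c /set_mem Ac cmin] := EVT_min_rV A0 cA cf.
exists [tuple c 0 i | i < d]; split.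
  apply/lp_ballP => //; under eq_bigr do rewrite tnth_mktuple.
  exact: Ac.
move=> u /(lp_ballP _ p0 r0) uball; rewrite /sqdist.
under eq_bigr do rewrite tnth_mktuple.
have -> : \sum_(i < d) (tnth u i - tnth y i) ^+ 2 =
    \sum_(i < d) ((\row_j tnth u j) 0 i - tnth y i) ^+ 2.
  by apply: eq_bigr => i _; rewrite mxE.
by apply: cmin; rewrite inE /A/=; under eq_bigr do rewrite mxE.
Qed.

(** The supremum is bounded below by the risk at the k-sparse theta. The factor 1/2 is the
    probability of the good event, on which the loss is at least e^(-40) |theta|^2. *)
Lemma mle_risk_ge (R : realType) (d k : nat) (p q r s : R) :
  1 < p -> p < 2 -> p^-1 + q^-1 = 1 ->
  (1 <= k)%N -> k%:R * expR (10 * q) <= d%:R -> 0 < r -> 0 < s ->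
  r * k%:R `^ (1 - 2 / p) <= expR (- 9) * (s * (Num.sqrt q * d%:R `^ q^-1)) ->
  ((expR (- 40) / 2 * (r ^+ 2 * k%:R `^ (1 - 2 / p)))%:E <=
   mle_risk (lp_ball d p r) s)%E.
Proof.
move=> p1 p2 pq k1 kd r0 s0 rs.
have p0 : 0 < p by lra.
have q0 := conjugate_gt1 p1 pq.
have q2 : 2 <= q.
  have : 2^-1 < p^-1 by rewrite ltf_pV2 ?posrE//; lra.
  have qi : q^-1 * q = 1 by rewrite mulVf ?gt_eqF.
  by move=> ph; have : 0 < (2^-1 - q^-1) * q; [rewrite mulr_gt0//; lra|lra].
have k0 : 0 < k%:R :> R by rewrite ltr0n.
pose a := r * k%:R `^ (- p^-1).
have a0 : 0 < a by rewrite mulr_gt0// powR_gt0.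
pose th (i : 'I_d) : R := if (i < k)%N then a else 0.
pose theta := [tuple th i | i < d].
have ththeta i : tnth theta i = th i by rewrite tnth_mktuple.
have [A [mA PA] HA] := gauss_good_event theta s0 q2 k1 kd.
set c := expR (- 40) * (r ^+ 2 * k%:R `^ (1 - 2 / p)).
have c0 : 0 <= c.
  by apply: mulr_ge0; [exact: expR_ge0|apply: mulr_ge0; [exact: sqr_ge0|exact: powR_ge0]].
have thball : lp_ball d p r theta.
  apply/lp_ballP => //; first exact: ltW.
  rewrite -(spread_lp k0 r0 p0) -/a.
  under eq_bigr do rewrite ththeta.
  have kd' : (k <= d)%N.
    rewrite -(ler_nat R); apply: le_trans kd; rewrite ler_peMr ?(ltW k0)//.
    by rewrite -[leLHS]expR0 ler_expR; lra.
  have -> : k%:R * a `^ p = \sum_(i < d | (i < k)%N) a `^ p.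
    by rewrite sumr_const card_ord_lt// mulr_natl.
  rewrite [leRHS]big_mkcond/=; apply: ler_sum => i _; rewrite /th.
  by case: ifP => _; rewrite ?normr0 ?powR0 ?gt_eqF// gtr0_norm.
apply: (@le_trans _ _ ('E_(gauss theta s)[fun y => sqdist (euclid_proj (lp_ball d p r) y) theta])%E); last first.
  by apply: ereal_sup_ubound; exists theta.
rewrite unlock.
apply: (@le_trans _ _ (c%:E * gauss theta s A)%E).
  rewrite mulrAC EFinM lee_wpmul2l// lee_fin.
apply: ge0_integral_lower => // [y|y Ay].
  by apply: sumr_ge0 => i _; exact: sqr_ge0.
have [g1 g2 g3] := HA y Ay.
have [tb tm] := euclid_projP y p1 (ltW r0).
set t := euclid_proj _ _ in tb tm *.
have yE i : tnth y i = th i + s * ((tnth y i - tnth theta i) / s).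
  by rewrite ththeta; field; rewrite gt_eqF.
have := @minimizer_far_from_sparse R d k p q r s (fun i => (tnth y i - tnth theta i) / s) (tnth t)
  p1 p2 pq k1 kd r0 s0 rs g1 g2 g3.
rewrite /sqdist /c => far.
have -> : \sum_(i < d) (tnth t i - tnth theta i) ^+ 2 =
    \sum_(i < d) (tnth t i - th i) ^+ 2.
  by apply: eq_bigr => i _; rewrite ththeta.
apply: far; first by apply/lp_ballP => //; exact: ltW.
move=> v vb; have vtb : lp_ball d p r [tuple v i | i < d].
  apply/lp_ballP => //; first exact: ltW.
  by under eq_bigr do rewrite tnth_mktuple.
have := tm _ vtb; rewrite /sqdist.
under eq_bigr do rewrite yE; under [leRHS]eq_bigr do rewrite yE tnth_mktuple.
exact.
Qed.

(** * Hard thresholding *)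

Definition hard_threshold (R : realType) (l x : R) : R :=
  if l < `|x| then x else 0.

Lemma measurable_hard_threshold (R : realType) (l : R) :
  measurable_fun [set: R] (hard_threshold l).
Proof.
apply: measurable_fun_ifT => //.
by apply: measurable_fun_ltr => //; exact: normr_measurable.
Qed.

(** The smaller of |t| and l, squared, splits into its powers p and 2 - p; the first is bounded by
    |t|^p and the second by l^(2-p). *)
Lemma sqr_le_powR_interp (R : realType) (p l t m : R) : 0 < p -> p < 2 -> 0 < l ->
  m <= t ^+ 2 -> m <= l ^+ 2 -> m <= `|t| `^ p * l `^ (2 - p).
Proof.
move=> p0 p2 l0 mt ml; have p20 : 0 <= 2 - p by lra.
have sqE (x : R) : 0 < x -> x ^+ 2 = x `^ p * x `^ (2 - p).
  move=> x0; rewrite -powRD; last by apply/implyP => _; rewrite gt_eqF.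
  by rewrite addrC subrK powR_mulrn// ltW.
have [tl|lt] := leP `|t| l.
- have [t0|t0] := eqVneq t 0.
    by apply: (le_trans mt); rewrite t0 expr0n mulr_ge0 ?powR_ge0.
  apply: (le_trans mt); rewrite -real_normK ?num_real// sqE ?normr_gt0//.
  by rewrite ler_wpM2l ?powR_ge0// ge0_ler_powR ?nnegrE// ltW.
- apply: (le_trans ml); rewrite sqE// ler_wpM2r ?powR_ge0//.
  by rewrite ge0_ler_powR ?nnegrE ?(ltW p0) ?(ltW l0)// ltW.
Qed.

(** If |x - t| <= l/2, the error is at most 3/2 times both |t| and l, whence 9/4. Otherwise the
    noise is atypically large and its square is paid for by the exponential term. *)
Lemma hard_threshold_error (R : realType) (p s l t x : R) :
  0 < p -> p < 2 -> 0 < s -> 0 < l ->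
  (hard_threshold l x - t) ^+ 2 <= 9 / 4 * (`|t| `^ p * l `^ (2 - p)) +
    16 * s ^+ 2 * expR (- (l ^+ 2 / (32 * s ^+ 2))) * expR (((x - t) / s) ^+ 2 / 4).
Proof.
move=> p0 p2 s0 l0; set z := (x - t) / s; set E := expR (- _).
set M := `|t| `^ p * _.
have M0 : 0 <= M by apply: mulr_ge0; exact: powR_ge0.
have mM m : m <= t ^+ 2 -> m <= l ^+ 2 -> m <= M by exact: sqr_le_powR_interp.
have x2 (a b : R) : `|a| <= b -> a ^+ 2 <= b ^+ 2.
  by move=> ab; rewrite -[leLHS]real_normK ?num_real// lerXn2r ?nnegrE ?(le_trans _ ab).
have E0 : 0 <= 16 * s ^+ 2 * E * expR (z ^+ 2 / 4).
  by rewrite mulr_ge0 ?expR_ge0// mulr_ge0 ?expR_ge0// mulr_ge0 ?sqr_ge0.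
have [ul|ul] := leP `|x - t| (l / 2).
  apply: (@le_trans _ _ (9 / 4 * M)); last by rewrite lerDl.
  rewrite -ler_pdivrMl; last by lra.
  apply: mM; rewrite ler_pdivrMl; [|lra| |lra]; rewrite /hard_threshold; case: ltP => lx.
  - have : l <= `|t| + l / 2.
      by have := ler_normD (x - t) t; rewrite subrK; lra.
    move=> lt; have : (x - t) ^+ 2 <= `|t| ^+ 2 by apply: x2; lra.
    by rewrite real_normK ?num_real//; have := sqr_ge0 t; lra.
  - by rewrite sub0r sqrrN; have := sqr_ge0 t; lra.
  - by have := x2 _ _ ul; have := sqr_ge0 l; lra.
  - rewrite sub0r sqrrN.
    have tx : `|t| <= 3 / 2 * l.
      by have := lerB_dist t x; rewrite (distrC t x); lra.
    by have := x2 _ _ tx; lra.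
(* Here |z| >= l / (2s), so z^2 / 8 <= z^2 / 4 - l^2 / (32 s^2), and z^2 <= 8 e^(z^2/8). The factor
   2 on the left serves the last case below. *)
have tail : 2 * (x - t) ^+ 2 <= 16 * s ^+ 2 * E * expR (z ^+ 2 / 4).
  have -> : (x - t) ^+ 2 = s ^+ 2 * z ^+ 2 by rewrite /z; field; rewrite gt_eqF.
  suff : z ^+ 2 <= 8 * (E * expR (z ^+ 2 / 4)).
    by have : 0 < s ^+ 2; [rewrite exprn_gt0|nra].
  apply: (@le_trans _ _ (8 * expR (z ^+ 2 / 8))).
    by have := expR_ge1Dx (z ^+ 2 / 8); lra.
  rewrite ler_pM2l// -expRD ler_expR.
  have : (l / (2 * s)) ^+ 2 <= z ^+ 2.
    apply: (@le_trans _ _ (`|z| ^+ 2)); last by rewrite real_normK ?num_real.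
    have lz : l / (2 * s) <= `|z|.
      rewrite /z normrM normfV (gtr0_norm s0) ler_pdivlMr// ltW//.
      by apply: le_lt_trans ul; rewrite le_eqVlt; apply/orP; left; apply/eqP; field; rewrite gt_eqF.
    have ls : 0 <= l / (2 * s) by rewrite ltW// divr_gt0// mulr_gt0.
    by rewrite lerXn2r ?nnegrE.
  rewrite (_ : l ^+ 2 / (32 * s ^+ 2) = (l / (2 * s)) ^+ 2 / 8); last by field; lra.
  lra.
rewrite /hard_threshold; case: ltP => lx.
  by have := sqr_ge0 (x - t); lra.
(* The entry is set to 0. If |t| > l, then |t| <= l + |x - t| gives t^2 <= 2 l^2 + 2 (x - t)^2. *)
rewrite sub0r sqrrN; have [tl|lt] := leP `|t| l.
  have := mM (t ^+ 2) (lexx _); move: (x2 _ _ tl) => tl2 /(_ tl2).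
  by have := sqr_ge0 (x - t); lra.
have l2M : l ^+ 2 <= M.
  apply: mM => //; rewrite -[leRHS]real_normK ?num_real//.
  by rewrite lerXn2r ?nnegrE ?(ltW l0)// ltW.
have tu : `|t| <= l + `|x - t|.
  by have := lerB_dist t x; rewrite (distrC t x); lra.
have := x2 _ _ tu; have := real_normK (num_real (x - t)).
have := sqr_ge0 (l - `|x - t|); nra.
Qed.

(** The estimator thresholds every coordinate at l. The termwise error bound is summed over the ball
    and integrated; 32 is 16 times the bound 2 for the moment sqrt 2. *)
Lemma minimax_risk_le (R : realType) (d : nat) (p r s l : R) :
  0 < p -> p < 2 -> 0 < r -> 0 < s -> 0 < l ->
  (minimax_risk (lp_ball d p r) s <=
   (9 / 4 * (r `^ p * l `^ (2 - p)) +
    d%:R * (32 * s ^+ 2 * expR (- (l ^+ 2 / (32 * s ^+ 2)))))%:E)%E.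
Proof.
move=> p0 p2 r0 s0 l0.
pose est (y : d.-tuple (measurableTypeR R)) : d.-tuple (measurableTypeR R) :=
  [tuple hard_threshold l (tnth y i) | i < d].
have mest : measurable_fun [set: _] est.
  apply/measurable_fun_tnthP => i.
  rewrite (_ : _ \o _ = (fun y : d.-tuple (measurableTypeR R) => hard_threshold l (tnth y i))).
    apply: (measurableT_comp (measurable_hard_threshold l)); exact: measurable_tnth.
  by apply/funext => y /=; rewrite tnth_mktuple.
apply: (@le_trans _ _ (max_risk (lp_ball d p r) s est)).
  by apply: ereal_inf_lbound; exists est.
apply: ub_ereal_sup => _ [theta /(lp_ballP _ p0 (ltW r0)) thb <-].
rewrite unlock.
set E := expR (- _).
set c := 16 * s ^+ 2 * E.
have c0 : 0 <= c by apply: mulr_ge0; [apply: mulr_ge0 => //; exact: sqr_ge0|exact: expR_ge0].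
pose f (i : 'I_d) (x : measurableTypeR R) := c * expR (((x - tnth theta i) / s) ^+ 2 / 4).
have f0 i x : 0 <= f i x by rewrite mulr_ge0 ?expR_ge0.
have mf i : measurable_fun [set: measurableTypeR R] (f i).
  apply: measurable_funM => //; apply: measurableT_comp => //.
  apply: measurable_funM => //; apply: measurable_funX.
  by apply: measurable_funM => //; exact: measurable_funB.
set c1 := 9 / 4 * _.
have c10 : 0 <= c1 by apply: mulr_ge0; [lra|apply: mulr_ge0; exact: powR_ge0].
have mX : measurable_fun [set: d.-tuple (measurableTypeR R)]
    (fun y => \sum_(i < d) f i (tnth y i)).
  exact: (measurable_sum_tnth xpredT).
apply: (@le_trans _ _ (\int[gauss theta s]_y (c1%:E + (\sum_(i < d) f i (tnth y i))%:E))%E).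
  apply: ge0_le_integral => //.
  - by move=> y _; rewrite lee_fin; apply: sumr_ge0 => i _; exact: sqr_ge0.
  - apply/measurable_EFinP.
    rewrite (_ : (fun y => _) = fun y : d.-tuple (measurableTypeR R) =>
        \sum_(i < d) (hard_threshold l (tnth y i) - tnth theta i) ^+ 2); last first.
      by apply/funext => y; apply: eq_bigr => i _; rewrite tnth_mktuple.
    apply: (@measurable_sum_tnth _ _ R d xpredT (fun (i : 'I_d) (x : measurableTypeR R) =>
      (hard_threshold l x - tnth theta i) ^+ 2)) => i.
    apply: measurable_funX; apply: measurable_funB => //.
    exact: measurable_hard_threshold.
  - by apply: emeasurable_funD => //; exact/measurable_EFinP.
  - move=> y _; rewrite -EFinD lee_fin.
    apply: (@le_trans _ _ (\sum_(i < d) (9 / 4 * (`|tnth theta i| `^ p * l `^ (2 - p)) + f i (tnth y i)))).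
      apply: ler_sum => i _; rewrite tnth_mktuple; exact: hard_threshold_error.
    rewrite big_split/= lerD2r -mulr_sumr -mulr_suml ler_pM2l ?ler_wpM2r ?powR_ge0//.
rewrite ge0_integralD//; last 2 first.
- by move=> y _; rewrite lee_fin; apply: sumr_ge0.
- exact/measurable_EFinP.
rewrite EFinD; apply: leeD.
  rewrite (integral_cst (gauss theta s) measurableT c1%:E) -[leRHS]mule1 -(probability_setT (gauss theta s)).
  exact: lexx.
have fK (i : 'I_d) : xpredT i -> (\int[normal_prob (tnth theta i) s]_x (f i x)%:E <= (2 * c)%:E)%E.
  move=> _; under eq_integral do rewrite EFinM.
  rewrite ge0_integralZl//; last first.
    apply/measurable_EFinP; apply: measurableT_comp => //.
    apply: measurable_funM => //; apply: measurable_funX.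
    by apply: measurable_funM => //; exact: measurable_funB.
  by rewrite normal_prob_expR_sqr// -EFinM lee_fin mulrC ler_wpM2r// sqrt2_le2.
have := integral_sum_tnth_le mf f0 fK.
by rewrite card_ord (_ : 32 * s ^+ 2 * E = 2 * c)// /c; ring.
Qed.

(** * Competitive ratio *)

Lemma minimax_risk_ge0 (R : realType) (d : nat) (p r s : R) :
  0 < p -> 0 <= r -> (0 <= minimax_risk (lp_ball d p r) s)%E.
Proof.
move=> p0 r0; apply: le_ereal_inf_tmp => _ [est _ <-].
pose o : d.-tuple R := [tuple 0 | i < d].
have b0 : lp_ball d p r o.
  apply/lp_ballP => //; rewrite big1 ?powR_ge0// => i _.
  by rewrite tnth_mktuple normr0 powR0 ?gt_eqF.
apply: (@le_trans _ _ ('E_(gauss o s)[fun y => sqdist (est y) o])%E).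
  rewrite unlock; apply: integral_ge0 => y _.
  by rewrite lee_fin; apply: sumr_ge0 => i _; exact: sqr_ge0.
by apply: ereal_sup_ubound; exists o.
Qed.

(** Inversion reverses the order on the nonnegative extended reals, so nonnegativity of the minimax
    risk suffices. *)
Lemma competitive_ratio_ge (R : realType) (d : nat) (p r s L U : R) :
  0 < p -> 0 <= r -> 0 < L -> 0 < U ->
  (L%:E <= mle_risk (lp_ball d p r) s)%E ->
  (minimax_risk (lp_ball d p r) s <= U%:E)%E ->
  ((L / U)%:E <= competitive_ratio (lp_ball d p r) s)%E.
Proof.
move=> p0 r0 L0 U0 LM mU; have m0 := minimax_risk_ge0 d s p0 r0.
rewrite /competitive_ratio EFinM; apply: lee_pmul => //.
- by rewrite lee_fin ltW.
- by rewrite lee_fin invr_ge0 ltW.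
- have -> : (U^-1)%:E = (U%:E^-1)%E :> \bar R by rewrite inver gt_eqF.
  by rewrite lee_pV2// inE// lee_fin ltW.
Qed.

(** The threshold is 6m because 36/32 >= 1 makes the exponent at least m^2 / s^2. The constant is 46
    >= 6 * 9/4 + 32, as 6^(2-p) <= 6. *)
Lemma minimax_risk_le_threshold (R : realType) (d : nat) (p r s m : R) :
  1 < p -> p < 2 -> 0 < r -> 0 < s -> 0 < m ->
  d%:R * (s ^+ 2 * expR (- (m ^+ 2 / s ^+ 2))) <= r `^ p * m `^ (2 - p) ->
  (minimax_risk (lp_ball d p r) s <= (46 * (r `^ p * m `^ (2 - p)))%:E)%E.
Proof.
move=> p1 p2 r0 s0 m0 dm; have p0 : 0 < p by lra.
apply: (le_trans (minimax_risk_le d p0 p2 r0 s0 (_ : 0 < 6 * m))); first by rewrite mulr_gt0.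
rewrite lee_fin; set X := r `^ p * _ in dm *.
have X0 : 0 <= X by apply: mulr_ge0; exact: powR_ge0.
have h1 : r `^ p * (6 * m) `^ (2 - p) <= 6 * X.
  rewrite powRM// ?(ltW m0)// mulrCA ler_wpM2r//.
  by rewrite -[leRHS]powRr1// ler_powR//; lra.
have h2 : d%:R * (32 * s ^+ 2 * expR (- ((6 * m) ^+ 2 / (32 * s ^+ 2)))) <= 32 * X.
  apply: (@le_trans _ _ (32 * (d%:R * (s ^+ 2 * expR (- (m ^+ 2 / s ^+ 2)))))); last first.
    by rewrite ler_pM2l.
  rewrite -[32 * _ * _]mulrA [leLHS]mulrCA ler_pM2l// ler_wpM2l//.
  rewrite ler_wpM2l ?sqr_ge0// ler_expR lerN2.
  have -> : (6 * m) ^+ 2 / (32 * s ^+ 2) = 9 / 8 * (m ^+ 2 / s ^+ 2) by field; rewrite gt_eqF.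
  have : 0 <= m ^+ 2 / s ^+ 2 by rewrite divr_ge0 ?sqr_ge0.
  lra.
lra.
Qed.

(** [K] is the real sparsity at which r K^(1-2/p) = B, and k is the next integer. If K <= 1 then k
    <= 2 and the risk has order r^2; otherwise k <= 2K and it has order r B. Rounding costs at most
    a factor 2. *)
Lemma mle_risk_ge_min (R : realType) (d : nat) (p q r s B : R) :
  1 < p -> p < 2 -> p^-1 + q^-1 = 1 -> 0 < r -> 0 < s ->
  B = expR (- 9) * (s * (Num.sqrt q * d%:R `^ q^-1)) ->
  2 * expR (10 * q) <= d%:R ->
  r / B <= (d%:R / (2 * expR (10 * q))) `^ (2 / p - 1) ->
  ((expR (- 40) / 4 * (r * Num.min r B))%:E <= mle_risk (lp_ball d p r) s)%E.
Proof.
move=> p1 p2 pq r0 s0 BE dE dB; have p0 : 0 < p by lra.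
have q0 := conjugate_gt1 p1 pq.
set E := expR _ in dE dB; have E0 : 0 < E by exact: expR_gt0.
have d0 : 0 < d%:R :> R by apply: lt_le_trans dE; rewrite mulr_gt0.
have B0 : 0 < B by rewrite BE !mulr_gt0 ?expR_gt0 ?sqrtr_gt0 ?powR_gt0.
have b0 : 0 < r / B by rewrite divr_gt0.
set al := 2 / p - 1 in dB *.
have al0 : 0 < al by rewrite subr_gt0 ltr_pdivlMr//; lra.
have al1 : al <= 1 by rewrite lerBlDr ler_pdivrMr//; lra.
set K := (r / B) `^ al^-1.
have K0 : 0 < K by rewrite powR_gt0.
have KA : K `^ al = r / B by rewrite -powRrM mulVf ?gt_eqF// powRr1// ltW.
have Kd : K <= d%:R / (2 * E).
  have -> : d%:R / (2 * E) = ((d%:R / (2 * E)) `^ al) `^ al^-1.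
    rewrite -powRrM divff ?gt_eqF// powRr1// ltW// divr_gt0// mulr_gt0//.
  by rewrite ge0_ler_powR ?nnegrE ?invr_ge0 ?powR_ge0 ?(ltW al0) ?(ltW b0).
have /andP[tK Kt] := truncn_itv (ltW K0).
(* The successor ensures both k >= 1 and K < k <= K + 1. *)
set k := (Num.truncn K).+1 in Kt.
have kK : k%:R <= K + 1 by rewrite /k -natr1 lerD2r.
have k0 : 0 < k%:R :> R by rewrite ltr0n.
have kE : 1 - 2 / p = - al by rewrite /al; ring.
apply: le_trans (@mle_risk_ge R d k p q r s p1 p2 pq _ _ r0 s0 _) => //.
- rewrite lee_fin kE.
  have -> : expR (- 40) / 4 * (r * Num.min r B) =
    expR (- 40) / 2 * r * (2^-1 * Num.min r B) by field.
  have -> : expR (- 40) / 2 * (r ^+ 2 * k%:R `^ (- al)) =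
    expR (- 40) / 2 * r * (r * k%:R `^ (- al)) by ring.
  rewrite ler_pM2l; last by rewrite mulr_gt0// divr_gt0// expR_gt0.
  have k2 (y : R) : 0 < y -> k%:R <= 2 * y -> 2^-1 * y `^ (- al) <= k%:R `^ (- al).
    move=> y0 ky; apply: (@le_trans _ _ ((2 * y) `^ (- al))).
      rewrite powRM// ?(ltW y0)// ler_wpM2r ?powR_ge0// powRN lef_pV2 ?posrE ?powR_gt0//.
      by rewrite -[leRHS]powRr1// ler_powR// ler1n.
    rewrite !powRN lef_pV2 ?posrE ?powR_gt0 ?mulr_gt0//.
    by rewrite ge0_ler_powR ?nnegrE ?(ltW al0) ?(ltW k0)// mulr_ge0// ltW.
  have [K1|K1] := leP K 1.
    have := k2 1 ltr01; rewrite powR1 !mulr1 => k21.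
    apply: (@le_trans _ _ (2^-1 * r)); first by rewrite ler_pM2l ?invr_gt0// ge_min lexx.
    by rewrite mulrC ler_pM2l// k21//; lra.
  have := k2 K K0; rewrite powRN KA => k21.
  apply: (@le_trans _ _ (2^-1 * B)); first by rewrite ler_pM2l ?invr_gt0// ge_min lexx orbT.
  have {}k21 : 2^-1 * (r / B)^-1 <= k%:R `^ (- al) by apply: k21; lra.
  rewrite -ler_pdivrMl//; apply: le_trans k21.
  by rewrite le_eqVlt; apply/orP; left; apply/eqP; field; rewrite !gt_eqF.
(* Both K and 1 are at most d / (2E), so k <= d / E; this is the reason for the factors 2 in the
   hypotheses. *)
- rewrite -/E -ler_pdivlMr//; apply: (le_trans kK).
  have : 1 <= d%:R / (2 * E) by rewrite ler_pdivlMr ?mulr_gt0// mul1r.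
  have -> : d%:R / E = d%:R / (2 * E) + d%:R / (2 * E) by field; rewrite gt_eqF.
  lra.
- rewrite -BE kE powRN ler_pdivrMr ?powR_gt0// mulrC -ler_pdivrMr// -KA.
  by rewrite ge0_ler_powR ?nnegrE ?(ltW al0) ?(ltW k0) ?(ltW K0)// ltW.
Qed.

(** Sparsity 1 makes the MLE risk of order r^2, against a minimax risk of order r^p m^(2-p) with m =
    s sqrt(ln d). For this m the factor d e^(-m^2/s^2) is exactly 1. *)
Lemma competitive_ratio_ge_vertex (R : realType) (d : nat) (p q r s : R) :
  1 < p -> p < 2 -> p^-1 + q^-1 = 1 -> 0 < r -> 0 < s ->
  expR (10 * q) <= d%:R ->
  r <= expR (- 9) * (s * (Num.sqrt q * d%:R `^ q^-1)) ->
  1 <= r / (s * Num.sqrt (ln d%:R)) ->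
  ((expR (- 40) / 92 * (r / (s * Num.sqrt (ln d%:R))) `^ (2 - p))%:E <=
   competitive_ratio (lp_ball d p r) s)%E.
Proof.
move=> p1 p2 pq r0 s0 dE rB rm; have p0 : 0 < p by lra.
have q0 := conjugate_gt1 p1 pq.
have d0 : 0 < d%:R :> R by apply: lt_le_trans dE; exact: expR_gt0.
set m := s * _ in rm *.
have ln0 : 0 < ln d%:R :> R.
  by apply: ln_gt0; apply: lt_le_trans dE; rewrite expR_gt1 mulr_gt0.
have ln1 : 1 <= ln d%:R :> R.
  rewrite -[leLHS]expRK ler_ln ?posrE ?expR_gt0//; apply: le_trans dE.
  rewrite ler_expR; have q1 : 1 < q; last lra.
  have : q^-1 < 1; last by rewrite invf_lt1.
  have : 0 < p^-1 by rewrite invr_gt0.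
  lra.
have m0 : 0 < m by rewrite mulr_gt0// sqrtr_gt0.
have mr : m <= r by move: rm; rewrite ler_pdivlMr// mul1r.
have L0 : 0 < expR (- 40) / 2 * (r ^+ 2 * 1%:R `^ (1 - 2 / p)) :> R.
  by rewrite powR1 mulr1; apply: mulr_gt0; [rewrite divr_gt0 ?expR_gt0|rewrite exprn_gt0].
have U0 : 0 < 46 * (r `^ p * m `^ (2 - p)).
  by apply: mulr_gt0 => //; apply: mulr_gt0; rewrite powR_gt0.
apply: le_trans (competitive_ratio_ge p0 (ltW r0) L0 U0 _ _).
- rewrite lee_fin powR1 mulr1 powR_div ?(ltW r0)//.
  rewrite [X in _ * (X / _)](_ : r `^ (2 - p) = r ^+ 2 / r `^ p); last first.
    by rewrite powRB ?powR_mulrn ?(ltW r0)//; apply/implyP => _; rewrite gt_eqF.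
  rewrite le_eqVlt; apply/orP; left; apply/eqP; field.
  by rewrite !gt_eqF ?powR_gt0.
- apply: (@mle_risk_ge R d 1 p q r s) => //; first by rewrite mul1r.
  by rewrite powR1 mulr1.
- apply: minimax_risk_le_threshold => //.
  have -> : m ^+ 2 / s ^+ 2 = ln d%:R.
    by rewrite exprMn sqr_sqrtr ?(ltW ln0)//; field; rewrite gt_eqF.
  rewrite expRN lnK ?posrE// mulrCA divff ?gt_eqF// mulr1.
  apply: (@le_trans _ _ (m ^+ 2)).
    rewrite lerXn2r ?nnegrE ?(ltW s0) ?(ltW m0)//.
    by rewrite ler_peMr ?(ltW s0)// -[leLHS]sqrtr1 ler_wsqrtr.
  have -> : m ^+ 2 = m `^ p * m `^ (2 - p).
    rewrite -powRD; last by apply/implyP => _; rewrite gt_eqF.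
    by rewrite addrC subrK powR_mulrn// ltW.
  by rewrite ler_wpM2r ?powR_ge0// ge0_ler_powR ?nnegrE ?(ltW p0) ?(ltW m0) ?(ltW r0).
Qed.

(** The two terms of the minimum correspond to the two regimes r^2 and r B of the MLE risk, each
    divided by the minimax bound 46 V. The constant is e^(-40)/4, divided by 46, times the e^(-9) in
    B. *)
Lemma competitive_ratio_ge_min (R : realType) (d : nat) (p q r s : R)
    (x := s * d%:R `^ p^-1 / r) (w := r / (s * Num.sqrt (ln d%:R))) :
  1 < p -> p < 2 -> p^-1 + q^-1 = 1 -> 0 < r -> 0 < s ->
  2 * expR (10 * q) <= d%:R ->
  expR 9 * (2 * expR (10 * q)) `^ (2 / p - 1) <= x ->
  expR 1 <= x -> 1 <= w ->
  ((expR (- 49) / 184 * Num.min (w `^ (2 - p)) (x `^ ((p - 1) / 2)))%:E <=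
   competitive_ratio (lp_ball d p r) s)%E.
Proof.
move=> p1 p2 pq r0 s0 dE xE x1 w1; have p0 : 0 < p by lra.
have q0 := conjugate_gt1 p1 pq.
have p11 : 0 < p - 1 by lra.
have p20 : 0 < 2 - p by lra.
have qE : q = p / (p - 1).
  have -> : q = (q^-1)^-1 by rewrite invrK.
  have -> : q^-1 = 1 - p^-1 by rewrite -pq addrAC subrr add0r.
  by field; lra.
have qV : q^-1 = (p - 1) / p by rewrite qE; field; lra.
have q1 : 1 <= q by rewrite qE ler_pdivlMr//; lra.
have sq1 : 1 <= Num.sqrt q by rewrite -[leLHS]sqrtr1 ler_wsqrtr.
have E0 : 0 < 2 * expR (10 * q) by rewrite mulr_gt0// expR_gt0.
have d0 : 0 < d%:R :> R by exact: lt_le_trans dE.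
have x0 : 0 < x by rewrite divr_gt0// mulr_gt0// powR_gt0.
have dxs : d%:R `^ p^-1 = x * r / s by rewrite /x; field; rewrite !gt_eqF.
have xp : x `^ p = s `^ p * d%:R / r `^ p.
  rewrite /x powR_div ?mulr_ge0 ?powR_ge0 ?(ltW s0)// powRM ?powR_ge0 ?(ltW s0)//.
  by rewrite -powRrM mulVf ?gt_eqF// powRr1 ?(ltW d0).
clearbody x.
have lnx1 : 1 <= ln x by rewrite -[leLHS]expRK ler_ln ?posrE ?expR_gt0.
have lnd1 : 1 <= ln d%:R :> R.
  rewrite -[leLHS]expRK ler_ln ?posrE ?expR_gt0//; apply: le_trans dE.
  apply: (@le_trans _ _ (1 * expR (10 * q))); last by rewrite ler_wpM2r ?expR_ge0// ler1n.
  by rewrite mul1r ler_expR; lra.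
set sd := s * Num.sqrt (ln d%:R) in w w1 *.
have sd1 : s <= sd by rewrite ler_peMr ?(ltW s0)// -[leLHS]sqrtr1 ler_wsqrtr.
have sd0 : 0 < sd by exact: lt_le_trans sd1.
have sdr : sd <= r by move: w1; rewrite /w ler_pdivlMr// mul1r.
(* Since y = ln (d s^p / r^p), the level m = s sqrt y gives d s^2 e^(-m^2/s^2) = r^p s^(2-p), which
   is at most V because s <= m. *)
set y := p * ln x.
have y1 : 1 <= y by rewrite /y; nra.
have y0 : 0 < y by lra.
set m := s * Num.sqrt y.
have m0 : 0 < m by rewrite mulr_gt0// sqrtr_gt0.
have sm : s <= m by rewrite ler_peMr ?(ltW s0)// -[leLHS]sqrtr1 ler_wsqrtr.
(* Amounts to x <= d^(1/p), that is, s <= r. *)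
have yd : y <= ln d%:R.
  have -> : ln d%:R = p * ln (d%:R `^ p^-1) :> R.
    by rewrite ln_powR mulrA divff ?gt_eqF// mul1r.
  rewrite /y ler_pM2l// ler_ln ?posrE ?powR_gt0//.
  rewrite dxs -mulrA ler_peMr ?(ltW x0)// ler_pdivlMr// mul1r.
  exact: le_trans sdr.
have msd : m <= sd by rewrite ler_pM2l// ler_wsqrtr.
set B := expR (- 9) * (s * (Num.sqrt q * d%:R `^ q^-1)).
have B0 : 0 < B.
  apply: mulr_gt0; first exact: expR_gt0.
  apply: mulr_gt0 => //; apply: mulr_gt0; last exact: powR_gt0.
  exact: lt_le_trans sq1.
have rBm0 : 0 < Num.min r B by rewrite lt_min r0 B0.
set L := expR (- 40) / 4 * (r * Num.min r B).
have L0 : 0 < L.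
  by apply: mulr_gt0; [rewrite divr_gt0// expR_gt0|exact: mulr_gt0].
set V := r `^ p * m `^ (2 - p).
have V0 : 0 < V by apply: mulr_gt0; rewrite powR_gt0.
have U0 : 0 < 46 * V by apply: mulr_gt0.
have xp1 : d%:R `^ q^-1 * s = x `^ (p - 1) * r `^ (p - 1) * s `^ (2 - p).
  have -> : d%:R `^ q^-1 = (d%:R `^ p^-1) `^ (p - 1).
    by rewrite -powRrM qV; congr powR; ring.
  rewrite dxs powR_div ?mulr_ge0 ?(ltW x0) ?(ltW r0)// powRM ?(ltW x0) ?(ltW r0)//.
  have -> : 2 - p = 1 - (p - 1) by ring.
  rewrite [s `^ (1 - _)]powRB ?powRr1 ?(ltW s0)//; last by apply/implyP => _; rewrite gt_eqF.
  by field; rewrite gt_eqF// powR_gt0.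
apply: le_trans (competitive_ratio_ge p0 (ltW r0) L0 U0 _ _).
- rewrite lee_fin.
  have h1 : w `^ (2 - p) <= r * r / V.
    rewrite /V invfM mulrA (_ : r * r / r `^ p = r `^ (2 - p)); last first.
      by rewrite powRB ?powR_mulrn ?(ltW r0)//; apply/implyP => _; rewrite gt_eqF.
    rewrite -powR_div ?(ltW r0)//.
    rewrite ge0_ler_powR ?nnegrE ?divr_ge0 ?(ltW p20) ?(ltW r0) ?(ltW sd0) ?(ltW m0)//.
    by rewrite ler_pM2l// lef_pV2 ?posrE.
  have h2 : expR (- 9) * x `^ ((p - 1) / 2) <= r * B / V.
    rewrite ler_pdivlMr//.
    have -> : r * B = expR (- 9) * (Num.sqrt q * x `^ (p - 1) * (r `^ p * s `^ (2 - p))).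
      rewrite /B (_ : s * (Num.sqrt q * d%:R `^ q^-1) = Num.sqrt q * (d%:R `^ q^-1 * s)); last by ring.
      rewrite xp1 [r `^ (p - 1)]powRB ?powRr1 ?(ltW r0)//; last by apply/implyP => _; rewrite gt_eqF.
      by field; rewrite gt_eqF.
    rewrite -[leLHS]mulrA ler_pM2l ?expR_gt0//.
    have -> : V = m `^ (2 - p) * r `^ p by rewrite mulrC.
    have -> : m `^ (2 - p) = Num.sqrt y `^ (2 - p) * s `^ (2 - p).
      by rewrite /m powRM ?(ltW s0) ?sqrtr_ge0// mulrC.
    have sy1 : 1 <= Num.sqrt y by rewrite -[leLHS]sqrtr1 ler_wsqrtr.
    have sy : Num.sqrt y `^ (2 - p) <= Num.sqrt y.
      by rewrite -[leRHS]powRr1 ?sqrtr_ge0// ler_powR//; lra.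
    have xh : x `^ (p - 1) = x `^ ((p - 1) / 2) * x `^ ((p - 1) / 2).
      by rewrite -powRD; [congr powR; field|apply/implyP => _; rewrite gt_eqF].
    (* From ln u < u at u = x^(p-1), using q = p / (p - 1). Half of the power x^(p-1) is thus spent
       on the logarithm in m, which explains the exponent (p-1)/2. *)
    have syq : Num.sqrt y <= Num.sqrt q * x `^ ((p - 1) / 2).
      rewrite -[x `^ _]ger0_norm ?powR_ge0// -sqrtr_sqr expr2 -xh -sqrtrM ?(ltW q0)//.
      apply: ler_wsqrtr; rewrite /y qE.
      have := ln_sublinear (_ : 0 < x `^ (p - 1)); rewrite powR_gt0// => /(_ isT).
      rewrite ln_powR => lx.
      have -> : p * ln x = p / (p - 1) * ((p - 1) * ln x) by field; lra.
      by rewrite ler_pM2l ?divr_gt0// ltW.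
    set a1 := x `^ ((p - 1) / 2) in xh syq *.
    rewrite [leLHS](_ : _ = (a1 * Num.sqrt y `^ (2 - p)) * (r `^ p * s `^ (2 - p))); last by ring.
    rewrite ler_wpM2r ?mulr_ge0 ?powR_ge0// xh mulrCA ler_wpM2l ?powR_ge0//.
    exact: le_trans syq.
  have e9 : expR (- 9) <= 1 :> R by rewrite expR_le1; lra.
  have -> : L / (46 * V) = expR (- 40) / 184 * (r * Num.min r B / V).
    by rewrite /L; field; rewrite gt_eqF.
  have -> : expR (- 49) = expR (- 40) * expR (- 9) :> R by rewrite -expRD; congr expR; ring.
  rewrite (_ : _ * _ / 184 * _ = expR (- 40) / 184 * (expR (- 9) *
    Num.min (w `^ (2 - p)) (x `^ ((p - 1) / 2)))); last by field.
  rewrite ler_pM2l ?divr_gt0 ?expR_gt0//.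
  rewrite /Num.min; case: (r < B).
    apply: le_trans h1; apply: (@le_trans _ _ (1 * w `^ (2 - p))); last by rewrite mul1r.
    apply: ler_pM; rewrite ?expR_ge0//; first by case: ifP; rewrite powR_ge0.
    by have := ge_min (w `^ (2 - p)) (w `^ (2 - p)) (x `^ ((p - 1) / 2)); rewrite lexx /Num.min.
  apply: le_trans h2; rewrite ler_wpM2l ?expR_ge0//.
  by have := ge_min (x `^ ((p - 1) / 2)) (w `^ (2 - p)) (x `^ ((p - 1) / 2)); rewrite lexx orbT /Num.min.
- apply: (@mle_risk_ge_min R d p q r s B) => //.
  (* Because d^(2/p-1) = d^(1/p) / d^(1/q), the admissibility of the sparsity turns into a lower
     bound on x. *)
  set al := 2 / p - 1 in xE *.
  rewrite powR_div ?(ltW d0)// ler_pdivlMr ?powR_gt0// mulrAC ler_pdivrMr//.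
  have -> : d%:R `^ al = d%:R `^ p^-1 / d%:R `^ q^-1.
    rewrite -powRB; last by apply/implyP => _; rewrite gt_eqF.
    by congr powR; rewrite /al qV; field; lra.
  rewrite /B dxs.
  have dq : 0 < d%:R `^ q^-1 by rewrite powR_gt0.
  have -> : x * r / s / d%:R `^ q^-1 * (expR (- 9) * (s * (Num.sqrt q * d%:R `^ q^-1))) =
      r * (expR (- 9) * (x * Num.sqrt q)).
    by field; rewrite !gt_eqF.
  rewrite ler_pM2l// expRN ler_pdivlMl ?expR_gt0//.
  by apply: (le_trans xE); rewrite ler_peMr// ltW.
- apply: minimax_risk_le_threshold => //.
  have -> : m ^+ 2 / s ^+ 2 = ln (x `^ p).
    by rewrite exprMn sqr_sqrtr ?(ltW y0)// ln_powR -/y; field; rewrite gt_eqF.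
  rewrite expRN lnK ?posrE ?powR_gt0//.
  rewrite xp.
  have -> : d%:R * (s ^+ 2 / (s `^ p * d%:R / r `^ p)) = r `^ p * (s ^+ 2 / s `^ p).
    by field; rewrite !gt_eqF ?powR_gt0.
  rewrite ler_pM2l ?powR_gt0//.
  have -> : s ^+ 2 / s `^ p = s `^ (2 - p).
    by rewrite powRB ?powR_mulrn ?(ltW s0)//; apply/implyP => _; rewrite gt_eqF.
  by rewrite ge0_ler_powR ?nnegrE ?(ltW p20) ?(ltW s0) ?(ltW m0).
Qed.

(** * Passage to the limit *)

Lemma much_greater_near (R : realType) (f g : nat -> R) (A : R) :
  much_greater f g -> \forall d \near \oo, A <= f d / g d.
Proof. by move=> /cvgryPge; apply. Qed.

Lemma ge_powR_root (R : realType) (T w e : R) : 0 < e -> 0 <= T ->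
  T `^ e^-1 <= w -> T <= w `^ e.
Proof.
move=> e0 T0 Tw; have -> : T = (T `^ e^-1) `^ e.
  by rewrite -powRrM mulVf ?gt_eqF// powRr1.
by rewrite ge0_ler_powR ?nnegrE ?powR_ge0 ?(ltW e0)// (le_trans (powR_ge0 _ _) Tw).
Qed.

Theorem corollary2 (R : realType) :
  (forall (p : R) (sigma r : nat -> R),
     1 < p -> p < 2 ->
     (forall d, 0 < sigma d) -> (forall d, 0 < r d) ->
     much_greater (fun d => sigma d * d%:R `^ p^-1) r ->
     much_greater r (fun d => sigma d * Num.sqrt (ln d%:R)) ->
     competitive_ratio (lp_ball d p (r d)) (sigma d) @[d --> \oo] --> +oo%E)
  /\
  (forall p sigma r : nat -> R,
     (forall d, 1 <= p d) ->
     much_greater (fun d => p d - 1) (fun d => 1 / (1 + ln d%:R)) ->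
     (limn_esup (fun d => (p d)%:E) < 2%:E)%E ->
     (forall d, 0 < sigma d) -> (forall d, 0 < r d) ->
     much_greater (fun d => sigma d * d%:R `^ (p d)^-1)
       (fun d => r d * d%:R `^ (2 / p d - 1) * Num.sqrt (1 - 1 / p d)) ->
     much_greater r (fun d => sigma d * Num.sqrt (ln d%:R)) ->
     competitive_ratio (lp_ball d (p d) (r d)) (sigma d) @[d --> \oo] --> +oo%E).
Proof.
split.
- move=> p sigma r p1 p2 s0 r0 hx hw; apply/cvgeyPge => A.
  pose q := p / (p - 1).
  have pq : p^-1 + q^-1 = 1 by rewrite /q; field; lra.
  set c : R := expR (- 49) / 184.
  have c0 : 0 < c by rewrite divr_gt0// expR_gt0.
  (* As p is fixed, all lower bounds required of w, x and d are constants, so they hold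
     eventually. *)
  set T : R := `|A| / c.
  have T0 : 0 <= T by rewrite divr_ge0// ltW.
  have p20 : 0 < 2 - p by lra.
  have p10 : 0 < (p - 1) / 2 by rewrite divr_gt0//; lra.
  near=> d.
  apply: le_trans (competitive_ratio_ge_min p1 p2 pq (r0 d) (s0 d) _ _ _ _).
  + rewrite lee_fin -/c; apply: (le_trans (ler_norm A)).
    rewrite mulrC -ler_pdivrMr// -/T le_min; apply/andP; split; apply: ge_powR_root => //.
      by near: d; exact: much_greater_near hw.
    by near: d; exact: much_greater_near hx.
  + by near: d; exact: nbhs_infty_ger.
  + by near: d; exact: much_greater_near hx.
  + by near: d; exact: much_greater_near hx.
  + by near: d; exact: much_greater_near hw.
- move=> p sigma r p1 hp hlim s0 r0 hx hw; apply/cvgeyPge => A.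
  (* The upper limit is an infimum of suprema over tails, so some tail supremum is below 2. The
     value -oo for it is contradictory, and the witness 0 is then arbitrary. *)
  have [rho [rho2 hrho]] : exists rho, rho < 2 /\ \forall d \near \oo, p d <= rho.
    move: hlim => /ereal_inf_lt[_ [S nS <-]].
    case E : (ereal_sup _) => [b| |] // b2.
    - exists b; split; first by rewrite -lte_fin.
      near=> d; rewrite -lee_fin -E; apply: ereal_sup_ubound; exists d => //.
      by near: d.
    - exists 0; split => //; near=> d.
      have : ((p d)%:E <= -oo)%E; last by rewrite leeNy_eq.
      by rewrite -E; apply: ereal_sup_ubound; exists d => //; near: d.
  clear hlim.
  set c : R := expR (- 40) / 92.
  have c0 : 0 < c by rewrite divr_gt0// expR_gt0.
  set T : R := `|A| / c.
  have T0 : 0 <= T by rewrite divr_ge0// ltW.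
  have rho20 : 0 < 2 - rho by lra.
  near=> d.
  have ln1 : 1 <= ln d%:R :> R.
    have de : expR 1 <= d%:R :> R by near: d; exact: nbhs_infty_ger.
    by rewrite -[leLHS]expRK ler_ln ?posrE ?expR_gt0// (lt_le_trans _ de) ?expR_gt0.
  have d1 : 1 <= d%:R :> R by near: d; exact: nbhs_infty_ger.
  have d0 : 0 < d%:R :> R by lra.
  have prho : p d <= rho by near: d.
  have p2 : p d < 2 by lra.
  (* As ln d >= 1, this gives (p - 1) ln d >= 20, hence 10 q = 10 p / (p - 1) <= ln d. *)
  have pln : 40 <= (p d - 1) / (1 / (1 + ln d%:R)) by near: d; exact: much_greater_near hp.
  have {}pln : 40 <= (p d - 1) * (1 + ln d%:R) by move: pln; rewrite div1r invrK.
  have p1' : 1 < p d by nra.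
  pose q := p d / (p d - 1).
  have pq : (p d)^-1 + q^-1 = 1 by rewrite /q; field; lra.
  have w1 : 1 <= r d / (sigma d * Num.sqrt (ln d%:R)) by near: d; exact: much_greater_near hw.
  apply: le_trans (competitive_ratio_ge_vertex p1' p2 pq (r0 d) (s0 d) _ _ w1).
  + rewrite lee_fin -/c; apply: (le_trans (ler_norm A)).
    rewrite mulrC -ler_pdivrMr// -/T.
    (* The base is at least 1, so the varying exponent 2 - p may be lowered to the fixed positive 2
       - rho. *)
    apply: (@le_trans _ _ ((r d / (sigma d * Num.sqrt (ln d%:R))) `^ (2 - rho))); last first.
      by rewrite ler_powR//; lra.
    apply: ge_powR_root => //.
    by near: d; exact: much_greater_near hw.
  + rewrite -[leRHS]lnK ?posrE// ler_expR /q mulrA ler_pdivrMr; last by lra.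
    nra.
  (* With 1 - 1/p = 1/q and d^(1/p) = d^(2/p-1) d^(1/q), this ratio is sigma sqrt q d^(1/q) / r, the
     quantity that makes a single nonzero entry admissible. *)
  + have hx9 : expR 9 <= sigma d * d%:R `^ (p d)^-1 /
        (r d * d%:R `^ (2 / p d - 1) * Num.sqrt (1 - 1 / p d)).
      by near: d; exact: much_greater_near hx.
    have q0 := conjugate_gt1 p1' pq.
    have sq0 : 0 < Num.sqrt q by rewrite sqrtr_gt0.
    move: hx9; rewrite (_ : 1 - 1 / p d = q^-1); last by rewrite /q; field; lra.
    rewrite sqrtrV ?(ltW q0)//.
    rewrite (_ : d%:R `^ (p d)^-1 = d%:R `^ (2 / p d - 1) * d%:R `^ q^-1); last first.
      rewrite -powRD; last by apply/implyP => _; rewrite gt_eqF.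
      by congr powR; rewrite /q; field; lra.
    have dd : 0 < d%:R `^ (2 / p d - 1) by rewrite powR_gt0.
    have -> : sigma d * (d%:R `^ (2 / p d - 1) * d%:R `^ q^-1) /
        (r d * d%:R `^ (2 / p d - 1) * (Num.sqrt q)^-1) =
        sigma d * (Num.sqrt q * d%:R `^ q^-1) / r d.
      by field; rewrite !gt_eqF.
    by rewrite ler_pdivlMr// expRN -ler_pdivlMl ?expR_gt0// invrK.
Unshelve. all: by end_near. Qed.
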